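(* Let $q\ge 3$, $r\in\mathbb{N}$, $s\in\mathbb{N}$, and let $Y_s=\{y_i\}_{i=1}^{2s}$ be any collection of points with $y_{2s}<y_{2s-1}<\cdots<y_1<y_{2s}+2\pi=:y_0$. Then there exists a function $f\in\Delta^{(q)}(Y_s)\cap W^r$ such that $$\limsup_{n\to\infty} n^r E_n^{(q)}(f,Y_s)=\infty.$$
   Context: A function $f\in C[a,b]$ is called $q$-monotone ($q\ge 2$) if $f\in C^{q-2}(a,b)$ and $f^{(q-2)}$ is convex on $(a,b)$. For $Y_s$ as in the claim, $\Delta^{(q)}(Y_s)$ denotes the set of continuous $2\pi$-periodic functions $f:\mathbb{R}\to\mathbb{R}$ such that $(-1)^{i-1}f$ is $q$-monotone on $[y_i,y_{i-1}]$ for each $1\le i\le 2s$. $W^r$ denotes the class of $2\pi$-periodic functions $f$ with $f^{(r-1)}$ locally absolutely continuous on $\mathbb{R}$ and $\operatorname{ess\,sup}_{x\in\mathbb{R}}|f^{(r)}(x)|\le 2$. $\mathcal{T}_n$ is the space of real trigonometric polynomials $\alpha_0+\sum_{k=1}^n(\alpha_k\cos kt+\beta_k\sin kt)$ of degree $\le n$. For a continuous $2\pi$-periodic $g$, $\|g\|=\max_{x\in\mathbb{R}}|g(x)|$, and $E_n^{(q)}(g,Y_s):=\inf_{T_n\in\mathcal{T}_n\cap\Delta^{(q)}(Y_s)}\|g-T_n\|$. *)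

(* Defs.v *)
From HB Require Import structures.
From mathcomp Require Import all_boot all_order all_algebra.
From mathcomp Require Import all_classical all_reals all_analysis ess_sup_inf.
Set Implicit Arguments. Unset Strict Implicit. Unset Printing Implicit Defensive.
Import Order.TTheory GRing.Theory Num.Theory.
Import numFieldNormedType.Exports.
Local Open Scope classical_set_scope.
Local Open Scope ring_scope.

Section Defs.
Variable R : realType.

Definition convex_on_open (a b : R) (h : R -> R) : Prop :=
  forall x y t : R, a < x < b -> a < y < b -> 0 <= t <= 1 ->
    h (t * x + (1 - t) * y) <= t * h x + (1 - t) * h y.

Definition q_monotone (q : nat) (a b : R) (g : R -> R) : Prop :=
  {within `[a, b], continuous g} /\
  (forall k : nat, (k < q - 2)%N -> forall x, a < x < b ->
      derivable (derive1n k g) x 1) /\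
  (forall k : nat, (k <= q - 2)%N -> forall x, a < x < b ->
      {for x, continuous (derive1n k g)}) /\
  convex_on_open a b (derive1n (q - 2) g).

Definition periodic2pi (f : R -> R) : Prop := forall x, f (x + 2 * pi) = f x.

Definition knot (y : nat -> R) (s i : nat) : R :=
  if i == 0%N then y (2 * s)%N + 2 * pi else y i.

Definition Delta (q : nat) (y : nat -> R) (s : nat) (f : R -> R) : Prop :=
  continuous f /\ periodic2pi f /\
  forall i : nat, (1 <= i <= 2 * s)%N ->
    q_monotone q (knot y s i) (knot y s i.-1) (fun x => (-1) ^+ i.-1 * f x).

Definition abs_cont_on (a b : R) (F : R -> R) : Prop :=
  forall e : R, 0 < e -> exists2 d : R, 0 < d &
    forall (n : nat) (u v : nat -> R),
      (forall i, (i < n)%N -> a <= u i /\ u i <= v i /\ v i <= b) ->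
      (forall i, (i.+1 < n)%N -> v i <= u i.+1) ->
      \sum_(i < n) (v i - u i) < d ->
      \sum_(i < n) `|F (v i) - F (u i)| < e.

Definition loc_abs_cont (F : R -> R) : Prop :=
  forall a b : R, a <= b -> abs_cont_on a b F.

Definition W (r : nat) (f : R -> R) : Prop :=
  periodic2pi f /\
  (forall k : nat, (k < r.-1)%N -> forall x, derivable (derive1n k f) x 1) /\
  loc_abs_cont (derive1n r.-1 f) /\
  (ess_sup lebesgue_measure
     (fun x => (`| derive1 (derive1n r.-1 f) x |)%:E) <= 2%:E)%E.

Definition trig_poly (n : nat) (T : R -> R) : Prop :=
  exists a b : nat -> R, forall t : R,
    T t = a 0%N + \sum_(1 <= k < n.+1) (a k * cos (k%:R * t) + b k * sin (k%:R * t)).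

Definition unorm (g : R -> R) : \bar R :=
  ereal_sup [set (`| g x |)%:E | x in [set: R]].

Definition En (q : nat) (y : nat -> R) (s n : nat) (g : R -> R) : \bar R :=
  ereal_inf [set unorm (fun x => g x - T x) | T in
             [set T | trig_poly n T /\ Delta q y s T]].

End Defs.

(* Main.v *)
Require Import Defs.
From HB Require Import structures.
From mathcomp Require Import all_boot all_order all_algebra.
From mathcomp Require Import all_classical all_reals all_analysis ess_sup_inf.
From mathcomp Require Import lra ring zify.
Import Order.TTheory GRing.Theory Num.Theory.
Import numFieldNormedType.Exports.
Local Open Scope classical_set_scope.
Local Open Scope ring_scope.
Set Implicit Arguments.
Unset Strict Implicit.
Unset Printing Implicit Defensive.

(** Put c = y_1 and Pi(t) = prod_i sin((t - y_i)/2). A function T belongs to Delta^(q)(Y_s) only if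
    T^(q) Pi >= 0. Multiply Pi by cos((t - c)/2)^(2N) to get phi1, and replace the factor
    sin((t - c)/2) of phi1 by cos((t - c)/2) to get phi0, so that phi1(c) = 0 < phi0(c). If T has
    degree n, then T^(q) phi0 is orthogonal to cos(K(t - c)) with K = n + s + N + 1, and
    1 - cos(K x) <= 2K |sin(x/2)| yields
      int T^(q) phi0 = int T^(q) phi0 (1 - cos(K(t - c))) <= 2K int T^(q) phi1.
    Moving the q derivatives onto the test functions, any f with |f - T| <= e satisfies the same
    inequality up to an error of order n N^q e. It fails for small e when f^(q) carries a positive
    mass at distance h << 1/(n N) to the right of c, compensated by a negative mass between y_2 and
    y_1 which the factor cos^(2N) makes negligible.

    For r = q - 1 + p the masses are smoothed by p-fold differences of step h, which leaves a
    weight of order h^p, and f is a gliding-hump sum over a sequence of such h. For r <= q - 2 the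
    derivative f^(q-2) may itself jump at c; then int f^(q) Pi < 0 for a suitable f, and E_n(f)
    stays away from 0. *)

(** The test at one scale must not be spoiled by the humps of the other scales. Each hump keeps its
    mass at distance at least h from y_1, so a fixed partial sum pairs with both test waves only to
    order C tau^N with tau < 1, while the competing quantities are powers of N. Later humps are
    harmless because their weights are chosen after n and at least halve each time.

    Write n = N^A. The +2 in h = N^-(A + 2) makes n N h of order 1/N. The hump, of size h^p, must
    beat n N^q n^-r; with r = q - 1 + p this becomes q + 2p < A (q - 2). A suitable A exists for q
    >= 3, while for q = 2 no power works.

    A single periodic kink drags along a quadratic term that is concave everywhere. In the
    difference of two kinks these terms cancel, the profile is piecewise affine, and the sign
    pattern of the class can be met: the convex kink falls just to the right of y_1, the concave one
    between y_2 and y_1.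

    Test functions are stored as lists of waves, so that their degree and the sum of their
    coefficients are computed exactly; that sum is 1 for every N, which keeps all error constants
    free of N except through the degree. *)

Section Calculus.
Variable R : realType.
Implicit Types (f g u v F G : R -> R) (a b c x y t : R).

(** * Differentiation rules, primitives and the integral over a period *)

Lemma is_derive_add f g x a b :
  is_derive x 1 f a -> is_derive x 1 g b ->
  is_derive x 1 (fun t => f t + g t) (a + b).
Proof. by move=> fa gb; exact: is_deriveD. Qed.

Lemma is_derive_sub f g x a b :
  is_derive x 1 f a -> is_derive x 1 g b ->
  is_derive x 1 (fun t => f t - g t) (a - b).
Proof. by move=> fa gb; exact: is_deriveB. Qed.

Lemma is_derive_scale f x k a :
  is_derive x 1 f a -> is_derive x 1 (fun t => k * f t) (k * a).
Proof. by move=> fa; exact: (is_deriveZ k fa). Qed.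

Lemma is_derive_mul f g x a b :
  is_derive x 1 f a -> is_derive x 1 g b ->
  is_derive x 1 (fun t => f t * g t) (a * g x + f x * b).
Proof.
move=> fa gb; apply: is_derive_eq (is_deriveM fa gb) _.
by rewrite addrC [g x *: a]mulrC.
Qed.

Lemma is_derive_chain f g x a b :
  is_derive (g x) 1 f a -> is_derive x 1 g b ->
  is_derive x 1 (fun t => f (g t)) (a * b).
Proof. by move=> fa gb; exact: is_derive1_comp. Qed.

Lemma is_derive_affine k s x : is_derive x 1 (fun t => k * t + s) k.
Proof.
apply: is_derive_eq (is_derive_add (is_derive_scale k (is_derive_id x 1)) (is_derive_cst s x 1)) _.
by rewrite mulr1 addr0.
Qed.

Lemma is_derive_shift f s x a :
  is_derive (x + s) 1 f a -> is_derive x 1 (fun t => f (t + s)) a.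
Proof.
have d1 : is_derive x 1 (fun t => t + s) (1 : R).
  by apply: is_derive_eq (is_derive_add (is_derive_id x 1) (is_derive_cst s x 1)) _;
    rewrite addr0.
move=> fa; apply: is_derive_eq (is_derive_chain (g := fun t => t + s) fa d1) _.
by rewrite mulr1.
Qed.

Lemma is_derive_continuous f x a : is_derive x 1 f a -> {for x, continuous f}.
Proof.
by move=> fa; apply: differentiable_continuous; apply/derivable1_diffP; case: fa.
Qed.

Definition primitive F g := forall x, is_derive x 1 F (g x).

Lemma primitive_continuous F g : primitive F g -> continuous F.
Proof. by move=> Fg x; exact: is_derive_continuous (Fg x). Qed.

Lemma primitive_MVT F g a b : a <= b -> primitive F g ->
  exists2 c, a <= c <= b & F b - F a = g c * (b - a).
Proof.
move=> ab Fg; have [|c] := @MVT_segment R F g a b ab (fun x _ => Fg x).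
  exact/continuous_subspaceT/(primitive_continuous Fg).
by rewrite in_itv /= => cab E; exists c.
Qed.

Lemma primitive_unique_on F G g a b : a <= b ->
  (forall x, a < x < b -> is_derive x 1 F (g x)) ->
  (forall x, a < x < b -> is_derive x 1 G (g x)) ->
  {within `[a, b], continuous F} -> {within `[a, b], continuous G} ->
  F b - F a = G b - G a.
Proof.
move=> ab dF dG cF cG.
have [||c _] := @MVT_segment R (fun x => F x - G x) (fun=> 0) a b ab.
- move=> x; rewrite in_itv /= => xab.
  by apply: is_derive_eq (is_derive_sub (dF x xab) (dG x xab)) _; rewrite subrr.
- by move=> x; apply: continuousB; [exact: cF|exact: cG].
by rewrite mul0r; lra.
Qed.

Lemma primitive_from g a : continuous g ->
  exists F, forall x, a < x -> is_derive x 1 F (g x).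
Proof.
move=> cg; exists (fun x => \int[lebesgue_measure]_(t in `[a, x]) g t)%R => x ax.
have [||d e] := @continuous_FTC1_closed R g a x (x + 1) _ _ ax (cg x).
- by rewrite ltrDl.
- apply: continuous_compact_integrable; first exact: segment_compact.
  exact: continuous_subspaceT.
by split => //; rewrite -derive1E.
Qed.

(** The fundamental theorem of calculus gives a primitive to the right of a base point only.
    Reflecting [g] gives one to the left. Both live on (-1, 1), where they differ by a constant, so
    gluing at 0 after subtracting the values there keeps differentiability at 0. *)
Lemma exists_primitive g : continuous g -> exists F, primitive F g.
Proof.
move=> cg; have [P dP] := primitive_from (-1) cg.
have [|M dM] := @primitive_from (fun t => g (- t)) (-1).
  by move=> x; apply: continuous_comp; [exact: continuousN|exact: cg].
pose N x := - M (- x).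
have dN x : x < 1 -> is_derive x 1 N (g x).
  move=> x1; have dm : is_derive x 1 (fun t : R => - t) (-1 : R).
    by apply: is_derive_eq (is_deriveN (is_derive_id x 1)) _.
  have h := dM (- x) ltac:(lra); rewrite opprK in h.
  apply: is_derive_eq (is_deriveN (is_derive_chain (g := -%R) h dm)) _.
  by rewrite mulrN1 opprK.
pose F x := if 0 <= x then P x - P 0 else N x - N 0.
have PN x : -1 < x < 1 -> P x - P 0 = N x - N 0.
  move=> /andP[x1 x2].
  have cP a b : -1 < a -> {within `[a, b], continuous P}.
    move=> a1; apply: continuous_in_subspaceT => z; rewrite inE /= in_itv /= => /andP[az _].
    by apply: is_derive_continuous (dP z _); lra.
  have cN a b : b < 1 -> {within `[a, b], continuous N}.
    move=> a1; apply: continuous_in_subspaceT => z; rewrite inE /= in_itv /= => /andP[_ az].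
    by apply: is_derive_continuous (dN z _); lra.
  have [x0|x0] := lerP 0 x.
    apply: (@primitive_unique_on P N g 0 x) => //.
    - by move=> z /andP[z1 z2]; apply: dP; lra.
    - by move=> z /andP[z1 z2]; apply: dN; lra.
    - by apply: cP; lra.
    - by apply: cN; lra.
  suff : P 0 - P x = N 0 - N x by lra.
  apply: (@primitive_unique_on P N g x 0) => //; first exact: ltW.
  - by move=> z /andP[z1 z2]; apply: dP; lra.
  - by move=> z /andP[z1 z2]; apply: dN; lra.
  - by apply: cP; lra.
  - by apply: cN; lra.
exists F => x.
have sub k G d : is_derive x 1 G d -> is_derive x 1 (fun t => G t - k) d.
  by move=> h; apply: is_derive_eq (is_derive_sub h (is_derive_cst k x 1)) _; rewrite subr0.
have [x0|x0] := ltrP (-1) x.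
  apply: near_eq_is_derive (sub (P 0) _ _ (dP x x0)).
  near=> t; rewrite /F; case: ifPn => //; rewrite -ltNge => t0; rewrite -PN //.
  apply/andP; split; last lra.
  by near: t; exact: lt_nbhsr.
have x1 : x < 0 by lra.
apply: near_eq_is_derive (sub (N 0) _ _ (dN x _)); last lra.
near=> t; rewrite /F; case: ifPn => // t0; exfalso; move: t0; apply/negP; rewrite -ltNge.
by near: t; exact: lt_nbhsl.
Unshelve. all: by end_near.
Qed.

Definition prim g : R -> R := xget (fun=> 0) [set F | primitive F g].

Lemma primP g : continuous g -> primitive (prim g) g.
Proof. by move=> /exists_primitive[F dF]; rewrite /prim; case: xgetP => [G -> //|/(_ F)]. Qed.

(* The integral over a period of a continuous function, through primitives. *)
Definition circint g := prim g (2 * pi) - prim g 0.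

Lemma pi2_gt0 : 0 < 2 * pi :> R. Proof. by rewrite mulr_gt0 ?pi_gt0. Qed.

Lemma circintE g F : continuous g -> primitive F g -> circint g = F (2 * pi) - F 0.
Proof.
move=> cg dF; apply: (@primitive_unique_on _ _ g) => //.
- exact: ltW pi2_gt0.
- by move=> x _; exact: primP.
- exact/continuous_subspaceT/(primitive_continuous (primP cg)).
- exact/continuous_subspaceT/(primitive_continuous dF).
Qed.

Lemma circint_shift_prim g F a : periodic2pi g -> continuous g -> primitive F g ->
  circint g = F (a + 2 * pi) - F a.
Proof.
move=> pg cg dF; rewrite (circintE cg dF).
have := @is_derive_0_is_cst R (fun x => F (x + 2 * pi) - F x) 0 a.
rewrite add0r; apply => x.
by apply: is_derive_eq (is_derive_sub (is_derive_shift (dF _)) (dF x)) _; rewrite pg subrr.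
Qed.

(** Asking for the derivative inside one period only lets [g] be given there by a formula that fails
    elsewhere, as happens for the periodic parabola. *)
Lemma circint_on g F a : periodic2pi g -> continuous g -> continuous F ->
  (forall x, a < x < a + 2 * pi -> is_derive x 1 F (g x)) ->
  circint g = F (a + 2 * pi) - F a.
Proof.
move=> pg cg cF dF; rewrite (circint_shift_prim a pg cg (primP cg)).
apply: (@primitive_unique_on _ _ g) => //.
- by rewrite lerDl ltW ?pi2_gt0.
- by move=> x _; exact: primP.
- exact/continuous_subspaceT/(primitive_continuous (primP cg)).
- exact/continuous_subspaceT.
Qed.

Lemma continuous_add f g : continuous f -> continuous g -> continuous (fun x => f x + g x).
Proof. by move=> cf cg x; apply: continuousD; [exact: cf|exact: cg]. Qed.

Lemma continuous_sub f g : continuous f -> continuous g -> continuous (fun x => f x - g x).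
Proof. by move=> cf cg x; apply: continuousB; [exact: cf|exact: cg]. Qed.

Lemma continuous_mul f g : continuous f -> continuous g -> continuous (fun x => f x * g x).
Proof. by move=> cf cg x; apply: continuousM; [exact: cf|exact: cg]. Qed.

Lemma continuous_const c : continuous (fun _ : R => c).
Proof. by move=> x; exact: cst_continuous. Qed.

Lemma continuous_scale c f : continuous f -> continuous (fun x => c * f x).
Proof. by move=> cf; apply: continuous_mul => //; exact: continuous_const. Qed.

Lemma continuous_translate f s : continuous f -> continuous (fun x => f (x + s)).
Proof.
move=> cf x; apply: (@continuous_comp _ _ _ (fun x => x + s) f); last exact: cf.
by apply: continuous_add x; [move=> z; exact: cvg_id|exact: continuous_const].
Qed.

Lemma circintD f g : continuous f -> continuous g ->
  circint (fun x => f x + g x) = circint f + circint g.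
Proof.
move=> cf cg; rewrite (circintE (continuous_add cf cg) (F := fun x => prim f x + prim g x)).
  by rewrite /circint; lra.
by move=> x; apply: is_derive_add; exact: primP.
Qed.

Lemma circintZ k f : continuous f -> circint (fun x => k * f x) = k * circint f.
Proof.
move=> cf; rewrite (circintE (continuous_scale cf) (F := fun x => k * prim f x)).
  by rewrite /circint; lra.
by move=> x; apply: is_derive_scale; exact: primP.
Qed.

Lemma circintN f : continuous f -> circint (fun x => - f x) = - circint f.
Proof. by move=> cf; rewrite -mulN1r -circintZ//; congr circint; apply/funext => x; rewrite mulN1r. Qed.

Lemma circintB f g : continuous f -> continuous g ->
  circint (fun x => f x - g x) = circint f - circint g.
Proof.
move=> cf cg; rewrite -(circintN cg) -circintD//.
by move=> x; apply: continuousN; exact: cg.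
Qed.

Lemma circint_const k : circint (fun=> k) = 2 * pi * k.
Proof.
rewrite (circintE (F := fun x => k * x)) ?mulr0 ?subr0 1?mulrC//; first exact: continuous_const.
by move=> x; apply: is_derive_eq (is_derive_scale k (is_derive_id x 1)) _; rewrite mulr1.
Qed.

Lemma circint_ge0 g a : periodic2pi g -> continuous g ->
  (forall x, a <= x <= a + 2 * pi -> 0 <= g x) -> 0 <= circint g.
Proof.
move=> pg cg g0; rewrite (circint_shift_prim a pg cg (primP cg)).
have [|c cab ->] := @primitive_MVT (prim g) g a (a + 2 * pi) _ (primP cg).
  by rewrite lerDl ltW ?pi2_gt0.
by apply: mulr_ge0; [exact: g0|rewrite addrAC subrr add0r ltW ?pi2_gt0].
Qed.

Lemma le_circint f g : periodic2pi f -> periodic2pi g -> continuous f -> continuous g ->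
  (forall x, f x <= g x) -> circint f <= circint g.
Proof.
move=> pf pg cf cg fg; rewrite -subr_ge0 -circintB//.
apply: (@circint_ge0 _ 0) => [x||x _]; first by rewrite pf pg.
  exact: continuous_sub.
by rewrite subr_ge0.
Qed.

Lemma circint_norm_le g B : periodic2pi g -> continuous g ->
  (forall x, `|g x| <= B) -> `|circint g| <= 2 * pi * B.
Proof.
move=> pg cg gB; rewrite ler_norml -mulrN -!circint_const.
have pk (k : R) : periodic2pi (fun=> k) by [].
have ck := @continuous_const.
by apply/andP; split; apply: le_circint => // x; have := gB x; rewrite ler_norml => /andP[].
Qed.

Lemma circint_shift g s : periodic2pi g -> continuous g ->
  circint (fun x => g (x + s)) = circint g.
Proof.
move=> pg cg; rewrite (circintE (F := fun x => prim g (x + s))).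
- by rewrite add0r [2 * pi + s]addrC -(circint_shift_prim s pg cg (primP cg)).
- exact: continuous_translate.
- by move=> x; apply: is_derive_shift; exact: primP.
Qed.

Lemma circint_deriv u v : periodic2pi u -> primitive u v -> continuous v -> circint v = 0.
Proof. by move=> pu uv cv; rewrite (circintE cv uv) -[2 * pi]add0r pu subrr. Qed.

Lemma circint_parts u v u' v' : periodic2pi u -> periodic2pi v ->
  primitive u u' -> primitive v v' -> continuous u' -> continuous v' ->
  circint (fun x => u x * v' x) = - circint (fun x => u' x * v x).
Proof.
move=> pu pv du dv cu cv; apply/eqP; rewrite -addr_eq0 addrC -circintD; first last.
- exact/continuous_mul/cv/(primitive_continuous du).
- exact/(continuous_mul cu)/(primitive_continuous dv).
apply/eqP/(@circint_deriv (fun x => u x * v x)).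
- by move=> x; rewrite pu pv.
- by move=> x; exact: is_derive_mul.
- apply: continuous_add; apply: continuous_mul => //; exact: primitive_continuous.
Qed.

End Calculus.

(** * Finite sums of cosine waves: derivatives, products, orthogonality *)

Section CosineSums.
Variable R : realType.
Implicit Types (l : seq (R * R * R)) (t x y al : R).

(* A triple ((a, w), th) stands for the wave a cos (w t + th). *)
Definition cosum l t : R := \sum_(p <- l) p.1.1 * cos (p.1.2 * t + p.2).

(* Degree m in half-angles: the frequencies are -m/2, -m/2 + 1, ..., m/2. *)
Definition half_degree m l :=
  forall p, p \in l -> exists2 j : nat, (j <= m)%N & p.1.2 = j%:R - m%:R / 2.

Definition amplitude l : R := \sum_(p <- l) `|p.1.1|.

Definition dcosum l : seq (R * R * R) :=
  [seq (p.1.1 * p.1.2, p.1.2, p.2 + pi / 2) | p <- l].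

(** Product-to-sum formula for one factor cos (t/2 + al). Half-angle factors can thus be multiplied
    one at a time; the frequencies are integers again once their number is even. *)
Definition mul_half al l : seq (R * R * R) :=
  [seq (p.1.1 / 2, p.1.2 + 1 / 2, p.2 + al) | p <- l] ++
  [seq (p.1.1 / 2, p.1.2 - 1 / 2, p.2 - al) | p <- l].

Lemma cosum_cons p l t : cosum (p :: l) t = p.1.1 * cos (p.1.2 * t + p.2) + cosum l t.
Proof. by rewrite /cosum big_cons. Qed.

Lemma cosum_nil : cosum [::] = fun=> 0.
Proof. by apply/funext => t; rewrite /cosum big_nil. Qed.

Lemma is_derive_sin_affine w th t :
  is_derive t 1 (fun t => sin (w * t + th) : R) (w * cos (w * t + th)).
Proof.
apply: is_derive_eq (is_derive_chain (is_derive_sin _) (is_derive_affine w th t)) _.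
by rewrite mulrC.
Qed.

Lemma is_derive_cos_affine w th t :
  is_derive t 1 (fun t => cos (w * t + th) : R) (- w * sin (w * t + th)).
Proof.
apply: is_derive_eq (is_derive_chain (is_derive_cos _) (is_derive_affine w th t)) _.
by rewrite mulrC mulrN mulNr.
Qed.

Lemma cosum_primitive l : primitive (cosum l) (cosum (dcosum l)).
Proof.
elim: l => [|p l IH] t; first by rewrite cosum_nil; exact: is_derive_cst.
have -> : cosum (p :: l) = fun t => p.1.1 * cos (p.1.2 * t + p.2) + cosum l t.
  by apply/funext => u; rewrite cosum_cons.
rewrite /= cosum_cons; apply: is_derive_add; last exact: IH.
apply: is_derive_eq (is_derive_scale _ (is_derive_cos_affine _ _ _)) _.
by rewrite /= addrA cosDpihalf; ring.
Qed.

Lemma cosum_continuous l : continuous (cosum l).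
Proof. exact: primitive_continuous (@cosum_primitive l). Qed.

Lemma half_degree_cons m p l : half_degree m (p :: l) -> half_degree m l.
Proof. by move=> h q ql; apply: h; rewrite in_cons ql orbT. Qed.

Lemma half_degree_dcosum m l k : half_degree m l -> half_degree m (iter k dcosum l).
Proof.
move=> h; elim: k => [//|k IH] p /= /mapP[q ql ->] /=; exact: IH.
Qed.

Lemma norm_cosum_le l t : `|cosum l t| <= amplitude l.
Proof.
rewrite /cosum; apply: (le_trans (ler_norm_sum _ _ _)); apply: ler_sum => p _.
by rewrite normrM ler_piMr// cos_max.
Qed.

(** All frequencies lie between -m/2 and m/2, so in the coefficient norm Bernstein's inequality is
    immediate. Nothing is lost by using this norm, since [mul_half] preserves it. *)
Lemma amplitude_dcosum m l : half_degree m l ->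
  amplitude (dcosum l) <= m%:R / 2 * amplitude l.
Proof.
move=> h; rewrite /amplitude /dcosum big_map mulr_sumr big_seq [leRHS]big_seq.
apply: ler_sum => p /h[j jm ->] /=; rewrite normrM mulrC ler_wpM2r//.
have : (j%:R <= m%:R :> R) by rewrite ler_nat.
have : (0 <= j%:R :> R) by [].
by move=> ? ?; rewrite ler_norml; apply/andP; split; lra.
Qed.

Lemma amplitude_iter_dcosum m l k : half_degree m l ->
  amplitude (iter k dcosum l) <= (m%:R / 2) ^+ k * amplitude l.
Proof.
move=> h; elim: k => [|k IH]; first by rewrite expr0 mul1r.
rewrite iterS.
apply: (le_trans (amplitude_dcosum (half_degree_dcosum (k := k) h))).
by rewrite exprS -[leRHS]mulrA; apply: ler_wpM2l => //; rewrite divr_ge0.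
Qed.

Lemma cos_periodic_nat x j k : cos (x + (j%:R - k%:R) * (2 * pi)) = cos x :> R.
Proof.
have e n y : cos (y + n%:R * (2 * pi)) = cos y :> R.
  rewrite (_ : n%:R * (2 * pi) = (pi *+ 2) *+ n); last by rewrite -[RHS]mulr_natl -[pi *+ 2]mulr_natl.
  exact: (periodicn (@cosD2pi R)).
rewrite -(e k (x + _)) -[RHS](e j x); congr cos; ring.
Qed.

Lemma cosum_periodic m l : half_degree (2 * m) l -> periodic2pi (cosum l).
Proof.
move=> h t; rewrite /cosum big_seq [RHS]big_seq; apply: eq_bigr => p /h[j _ ->].
congr (_ * _); rewrite -[RHS](cos_periodic_nat _ j m); congr cos.
by rewrite natrM; field.
Qed.

Lemma cosum_cat l1 l2 t : cosum (l1 ++ l2) t = cosum l1 t + cosum l2 t.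
Proof. by rewrite /cosum big_cat. Qed.

Lemma mul_cos x y : cos x * cos y = (cos (x + y) + cos (x - y)) / 2 :> R.
Proof. by rewrite cosD cosB; field. Qed.

Lemma cosum_mul_half al l t : cosum (mul_half al l) t = cosum l t * cos (t / 2 + al).
Proof.
rewrite cosum_cat /cosum !big_map mulr_suml -big_split; apply: eq_bigr => p _ /=.
rewrite -!mulrA mul_cos.
rewrite (_ : p.1.2 * t + p.2 + (t / 2 + al) = (p.1.2 + 1 / 2) * t + (p.2 + al)); last by field.
rewrite (_ : p.1.2 * t + p.2 - (t / 2 + al) = (p.1.2 - 1 / 2) * t + (p.2 - al)); last by field.
by field.
Qed.

Lemma half_degree_mul_half m al l : half_degree m l -> half_degree m.+1 (mul_half al l).
Proof.
move=> h p; rewrite mem_cat => /orP[] /mapP[q /h[j jm e] ->] /=; rewrite e.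
  by exists j.+1 => //; rewrite -[j.+1]addn1 -[m.+1]addn1 !natrD; field.
by exists j; [exact: leqW|rewrite -[m.+1]addn1 natrD; field].
Qed.

Lemma amplitude_mul_half al l : amplitude (mul_half al l) = amplitude l.
Proof.
rewrite /amplitude big_cat !big_map /= -big_split; apply: eq_bigr => p _ /=.
by rewrite normrM (ger0_norm (x := 2^-1)); [field|lra].
Qed.

Definition mul_halves (als : seq R) l := foldr mul_half l als.

Lemma cosum_mul_halves als l t :
  cosum (mul_halves als l) t = cosum l t * \prod_(al <- als) cos (t / 2 + al).
Proof.
elim: als => [|al als IH] /=; first by rewrite big_nil mulr1.
by rewrite big_cons cosum_mul_half IH -mulrA [_ * cos _]mulrC.
Qed.

Lemma half_degree_mul_halves m als l :
  half_degree m l -> half_degree (size als + m) (mul_halves als l).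
Proof. by move=> h; elim: als => //= al als IH; exact: half_degree_mul_half. Qed.

Lemma amplitude_mul_halves als l : amplitude (mul_halves als l) = amplitude l.
Proof. by elim: als => //= al als IH; rewrite amplitude_mul_half. Qed.

Lemma circint_wave j k th : j != k ->
  circint (fun t => cos ((j%:R - k%:R) * t + th) : R) = 0.
Proof.
move=> jk; pose w : R := j%:R - k%:R.
have w0 : w != 0 by rewrite subr_eq0 eqr_nat.
apply: (@circint_deriv _ (fun t => w^-1 * sin (w * t + th))).
- move=> t /=; rewrite -!(cosBpihalf (w * _ + th)).
  rewrite -[in RHS](cos_periodic_nat _ j k); congr (_ * cos _).
  by rewrite /w; ring.
- move=> t; apply: is_derive_eq (is_derive_scale _ (is_derive_sin_affine _ _ _)) _.
  by rewrite mulrA mulVf// mul1r.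
- by apply: primitive_continuous => t; exact: is_derive_cos_affine.
Qed.

Lemma cos_affine_continuous w th : continuous (fun t => cos (w * t + th) : R).
Proof. by apply: primitive_continuous => t; exact: is_derive_cos_affine. Qed.

(** By product-to-sum, a wave of frequency j - m produces the frequencies j + K - m > 0 and j - m -
    K < 0 (as 0 <= j <= 2m), whose integrals over a period vanish. *)
Lemma cosum_orthogonal m l K th : half_degree (2 * m) l -> (m < K)%N ->
  circint (fun t => cosum l t * cos (K%:R * t + th)) = 0.
Proof.
move=> + mK; elim: l => [|p l IH] h.
  rewrite (_ : (fun _ => _) = fun=> 0) ?circint_const ?mulr0//.
  by apply/funext => t; rewrite cosum_nil mul0r.
have [j jm e] := h p (mem_head _ _).
have e' : p.1.2 = j%:R - m%:R by rewrite e natrM; field.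
rewrite (_ : (fun _ => _) = fun t =>
   (p.1.1 / 2 * cos (((j + K)%:R - m%:R) * t + (p.2 + th)) +
    p.1.1 / 2 * cos ((j%:R - (m + K)%:R) * t + (p.2 - th))) +
   cosum l t * cos (K%:R * t + th)).
  have c w ph a : continuous (fun t : R => a * cos (w * t + ph)).
    exact/continuous_scale/cos_affine_continuous.
  rewrite circintD; first last.
  - exact/continuous_mul/cos_affine_continuous/cosum_continuous.
  - by apply: continuous_add; exact: c.
  rewrite IH; last exact: half_degree_cons h.
  rewrite circintD; [|exact: c|exact: c].
  rewrite !circintZ; [|exact: cos_affine_continuous|exact: cos_affine_continuous].
  by rewrite !circint_wave; [lra|lia|lia].
apply/funext => t; rewrite cosum_cons mulrDl; congr (_ + _).
rewrite -mulrA mul_cos e' !natrD.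
rewrite (_ : (j%:R + K%:R - m%:R) * t + (p.2 + th) =
  (j%:R - m%:R) * t + p.2 + (K%:R * t + th)); last by ring.
rewrite (_ : (j%:R - (m%:R + K%:R)) * t + (p.2 - th) =
  (j%:R - m%:R) * t + p.2 - (K%:R * t + th)); last by ring.
by field.
Qed.

Lemma trig_poly_cosum n (T : R -> R) : trig_poly n T ->
  exists2 l, half_degree (2 * n) l & T = cosum l.
Proof.
move=> [a [b TE]].
exists ((a 0%N, 0, 0) ::
  flatten [seq [:: (a k, k%:R, 0); (b k, k%:R, - (pi / 2))] | k <- index_iota 1 n.+1]).
  move=> p; rewrite in_cons => /orP[/eqP -> /=|].
    by exists n; [lia|rewrite natrM; field].
  move=> /flattenP[s /mapP[k]]; rewrite mem_index_iota => /andP[k1 kn] ->.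
  rewrite !inE => /orP[] /eqP -> /=; exists (k + n)%N; try lia;
  by rewrite natrD natrM; field.
apply/funext => t; rewrite TE cosum_cons /= mul0r addr0 cos0 mulr1; congr (_ + _).
rewrite /cosum big_flatten big_map; apply: eq_bigr => k _.
by rewrite !big_cons big_nil /= !addr0 cosBpihalf.
Qed.

End CosineSums.

(** * From convexity to the sign of a second derivative; elementary sine bounds *)

Section ConvexSecondDerivative.
Variable R : realType.
Implicit Types (f g F w : R -> R) (a b x : R).

Lemma primitive_MVT_lt F g a b : a < b -> primitive F g ->
  exists2 c, a < c < b & F b - F a = g c * (b - a).
Proof.
move=> ab Fg; have [|c] := @MVT R F g a b ab (fun x _ => Fg x).
  exact/continuous_subspaceT/(primitive_continuous Fg).
by rewrite in_itv /= => cab E; exists c.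
Qed.

(** If [w2 x < 0], then [w2] is negative near x. The mean value theorem on both sides of x, and once
    more between the two intermediate points, contradicts midpoint convexity. *)
Lemma convex_second_derivative w w1 w2 a b x : convex_on_open a b w ->
  primitive w w1 -> primitive w1 w2 -> continuous w2 -> a < x < b -> 0 <= w2 x.
Proof.
move=> cw dw dw1 cw2 /andP[ax xb]; rewrite leNgt; apply/negP => w2x.
have [d d0 dP] : exists2 d, 0 < d & forall z, `|x - z| < d -> w2 z < 0.
  have h : \forall z \near x, w2 z < 0 by exact: cvgr_lt (w2 x) (cw2 x) _ w2x.
  by move/nbhs_ballP: h => [d /= d0 dP]; exists d => // z xz; exact: dP.
pose u := Num.min (d / 2) (Num.min ((x - a) / 2) ((b - x) / 2)).
have u0 : 0 < u by rewrite !lt_min; apply/and3P; split; lra.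
have ud : u <= d / 2 by rewrite ge_min lexx.
have ua : u <= (x - a) / 2 by rewrite !ge_min lexx orbT.
have ub : u <= (b - x) / 2 by rewrite !ge_min lexx !orbT.
have [|c1 c1b e1] := @primitive_MVT_lt w w1 x (x + u) _ dw; first by rewrite ltrDl.
have [|c2 c2b e2] := @primitive_MVT_lt w w1 (x - u) x _ dw; first by rewrite gtrDl oppr_lt0.
have [|c3 c3b e3] := @primitive_MVT_lt w1 w2 c2 c1 _ dw1; first lra.
have c3neg : w2 c3 < 0 by apply: dP; rewrite ltr_norml; lra.
have w1lt : w1 c1 < w1 c2.
  rewrite -subr_lt0 e3 pmulr_llt0 //; lra.
have := cw (x + u) (x - u) (1 / 2) ltac:(lra) ltac:(lra) ltac:(lra).
rewrite (_ : 1 / 2 * (x + u) + (1 - 1 / 2) * (x - u) = x); last by field.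
have : w1 c1 * u < w1 c2 * u by rewrite ltr_pM2r.
move: e1 e2; rewrite (_ : x + u - x = u); last by ring.
rewrite (_ : x - (x - u) = u); last by ring.
by lra.
Qed.

Lemma derive1n_chain m (g : nat -> R -> R) :
  (forall k, (k < m)%N -> primitive (g k) (g k.+1)) ->
  forall k, (k <= m)%N -> derive1n k (g 0%N) = g k.
Proof.
move=> dg; elim=> [//|k IH] km; rewrite derive1nS IH; last exact: ltnW.
by apply/funext => x; rewrite derive1E; case: (dg k km x).
Qed.

Lemma norm_sin_mulrn (K : nat) x : `|sin (K%:R * x)| <= K%:R * `|sin x|.
Proof.
elim: K => [|K IH]; first by rewrite !mul0r sin0 normr0.
rewrite -natr1 !mulrDl !mul1r sinD (le_trans (ler_normD _ _))//.
apply: lerD; rewrite normrM; last by rewrite ler_piMl// cos_max.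
by apply: le_trans IH; rewrite ler_piMr// cos_max.
Qed.

(** The middle term is 2 sin^2 (K x / 2); one sine is bounded by 1, the other by K |sin (x/2)|. Only
    the first power is kept because it matches the factor sin ((t - y_1)/2) of [phi1]. *)
Lemma one_sub_cos_le (K : nat) x : 0 <= 1 - cos (K%:R * x) <= 2 * K%:R * `|sin (x / 2)|.
Proof.
rewrite subr_ge0 cos_le1 /=.
have -> : K%:R * x = (K%:R * (x / 2)) *+ 2 by rewrite -mulr_natl; field.
rewrite cos_mulr2n cos2sin2.
have -> : 1 - ((1 - sin (K%:R * (x / 2)) ^+ 2) *+ 2 - 1) = 2 * sin (K%:R * (x / 2)) ^+ 2.
  by rewrite -mulr_natl; ring.
rewrite -mulrA ler_wpM2l// (le_trans _ (norm_sin_mulrn K (x / 2)))//.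
by rewrite -real_normK ?num_real// expr2 ler_piMl// sin_max.
Qed.

End ConvexSecondDerivative.

Lemma knots_antitone (R : realType) s (y : nat -> R) i j :
  (forall i : nat, (1 <= i < 2 * s)%N -> y i.+1 < y i) ->
  (1 <= i <= j)%N -> (j <= 2 * s)%N -> y j <= y i.
Proof.
move=> yd /andP[i1 ij] js; rewrite -(subnK ij) addnC.
have : (i + (j - i) <= 2 * s)%N by lia.
elim: (j - i)%N => [|k IH] h; first by rewrite addn0.
by rewrite addnS (le_trans (ltW (yd _ _)))//; [lia|apply: IH; lia].
Qed.

(** * The sign of T^(q) against the product of half-angle sines *)

Section KeyEstimate.
Variables (R : realType) (q s : nat) (y : nat -> R).
Hypothesis (q3 : (3 <= q)%N) (s1 : (1 <= s)%N).
Hypothesis y_decr : forall i : nat, (1 <= i < 2 * s)%N -> y i.+1 < y i.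
Hypothesis y_period : y 1%N < y (2 * s)%N + 2 * pi.

Let y_le i j := @knots_antitone R s y i j y_decr.

Definition knot_sines t := \prod_(1 <= i < (2 * s).+1) sin ((t - y i) / 2).

(** All half-angles lie in [-pi, pi]. The factors with index below i, of which there are i - 1, are
    nonpositive and absorb one sign each; the others are nonnegative. *)
Lemma knot_sines_sign i t : (1 <= i <= 2 * s)%N -> knot y s i < t < knot y s i.-1 ->
  0 <= (-1) ^+ i.-1 * knot_sines t.
Proof.
move=> /andP[i1 i2] /andP[t1 t2].
have yp := y_period.
have kle : knot y s i = y i by rewrite /knot; case: i i1 {i2 t1 t2}.
have yt j : (i <= j <= 2 * s)%N -> 0 <= sin ((t - y j) / 2).
  move=> /andP[ij js]; have h1 := @y_le i j ltac:(lia) js.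
  have h2 : t < y (2 * s)%N + 2 * pi.
    move: t2; rewrite /knot; case: ifP => // e t2.
    have := @y_le 1 i.-1 ltac:(lia) ltac:(lia); lra.
  have := @y_le j (2 * s) ltac:(lia) (leqnn _) => h3.
  by apply: sin_ge0_pi; rewrite kle in t1; lra.
have ty j : (1 <= j < i)%N -> sin ((t - y j) / 2) <= 0.
  move=> /andP[j1 ji]; rewrite -oppr_ge0 -sinN; apply: sin_ge0_pi.
  have ne : (i.-1 == 0)%N = false by apply/eqP; lia.
  move: t2; rewrite /knot ne => t2.
  have := @y_le j i.-1 ltac:(lia) ltac:(lia).
  have := @y_le 1 j ltac:(lia) ltac:(lia).
  have := @y_le i (2 * s) ltac:(lia) (leqnn _).
  by rewrite kle in t1; lra.
rewrite /knot_sines (big_cat_nat (n := i)) /=; [|lia|lia].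
rewrite mulrA mulr_ge0//; last first.
  by rewrite big_nat; apply: prodr_ge0 => j /andP[ij js]; apply: yt; lia.
have -> : (-1) ^+ i.-1 = \prod_(1 <= j < i) (-1) :> R by rewrite prodr_const_nat subn1.
rewrite -big_split /= big_nat; apply: prodr_ge0 => j ij.
by rewrite mulN1r oppr_ge0 ty.
Qed.

Lemma knot_cover t : y (2 * s)%N <= t <= y (2 * s)%N + 2 * pi ->
  exists2 i, (1 <= i <= 2 * s)%N & knot y s i <= t <= knot y s i.-1.
Proof.
move=> /andP[t1 t2].
have H k : (1 <= k <= 2 * s)%N -> knot y s k <= t ->
    exists2 i, (1 <= i <= 2 * s)%N & knot y s i <= t <= knot y s i.-1.
  elim: k => // k IH /andP[_ ks] kt; case: (posnP k) => [k0|k0].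
    by exists k.+1; [lia|rewrite kt k0].
  have [h|h] := leP (knot y s k) t; first by apply: IH => //; lia.
  by exists k.+1; [lia|rewrite kt /= ltW].
apply: (H (2 * s)%N); first lia.
by rewrite /knot ifF//; apply/eqP; lia.
Qed.

Lemma knot_sines0 i : (i <= 2 * s)%N -> knot_sines (knot y s i) = 0.
Proof.
move=> is2; have H j : (1 <= j <= 2 * s)%N -> sin ((knot y s i - y j) / 2) = 0 ->
    knot_sines (knot y s i) = 0.
  move=> js e; rewrite /knot_sines (bigD1_seq j) /= ?iota_uniq ?e ?mul0r//.
  by rewrite mem_index_iota; lia.
have [i0|i0] := posnP i; last first.
  apply: (H i); first lia.
  by rewrite /knot ifF ?subrr ?mul0r ?sin0//; apply/eqP; lia.
(* The knot of index 0 is [y (2 * s) + 2 * pi], so the factor belonging to [y (2 * s)] is sin pi. *)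
apply: (H (2 * s)%N); first lia.
by rewrite i0 /knot eqxx addrAC subrr add0r mulrAC mulfV ?pnatr_eq0// mul1r sinpi.
Qed.

(** Membership gives the sign of T^(q) only inside the knot intervals, where the two signs
    (-1)^(i-1) cancel; at the knots themselves the product of sines vanishes. *)
Lemma Delta_sign l t : Delta q y s (cosum l) ->
  y (2 * s)%N <= t <= y (2 * s)%N + 2 * pi ->
  0 <= cosum (iter q (@dcosum R) l) t * knot_sines t.
Proof.
move=> [_ [_ D]] /knot_cover[i i2 /andP[]].
rewrite le_eqVlt => /orP[/eqP <- _|t1]; first by rewrite knot_sines0 ?mulr0//; lia.
rewrite le_eqVlt => /orP[/eqP ->|t2]; first by rewrite knot_sines0 ?mulr0//; lia.
have [_ [_ [_ cv]]] := D i i2.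
set sg := (-1) ^+ i.-1 in cv.
pose g k x := sg * cosum (iter k (@dcosum R) l) x.
have dg k : primitive (g k) (g k.+1).
  by move=> x; apply: is_derive_scale; exact: cosum_primitive.
have := @derive1n_chain _ (q - 2) g (fun k _ => dg k) (q - 2)%N (leqnn _).
rewrite [g 0%N]/g /= => E; rewrite E in cv.
have h : 0 <= g q t.
  rewrite (_ : q = (q - 2).+2); last by have := q3; lia.
  apply: (convex_second_derivative cv (dg _) (dg _)); last by rewrite t1 t2.
  exact/continuous_scale/cosum_continuous.
have sgn := @knot_sines_sign i t i2; rewrite t1 t2 in sgn.
have := mulr_ge0 h (sgn isT); rewrite /g mulrACA -expr2 /sg -exprM mulnC exprM.
by rewrite sqrrN expr1n expr1n mul1r.
Qed.

End KeyEstimate.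

Section CircintPartsIter.
Variable R : realType.
Implicit Types (u v : nat -> R -> R) (f g : R -> R).

(** Here [u] stands for a function with finitely many derivatives and [v] for a smooth wave, whence
    the bounds on the index of [u] alone. *)
Lemma circint_parts_iter m u v :
  (forall k, (k <= m)%N -> periodic2pi (u k)) -> (forall k, periodic2pi (v k)) ->
  (forall k, (k <= m)%N -> continuous (u k)) -> (forall k, continuous (v k)) ->
  (forall k, (k < m)%N -> primitive (u k) (u k.+1)) ->
  (forall k, primitive (v k) (v k.+1)) ->
  circint (fun t => u 0%N t * v m t) = (-1) ^+ m * circint (fun t => u m t * v 0%N t).
Proof.
move=> + pv + cv + dv; elim: m u => [|m IH] u pu cu du; first by rewrite mul1r.
rewrite (circint_parts (u' := u 1%N) (v := v m)) //; [|exact: pu|exact: du|exact: cu].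
rewrite (IH (fun k => u k.+1)).
- by rewrite exprS mulN1r mulNr.
- by move=> k km; exact: (pu k.+1).
- by move=> k km; exact: (cu k.+1).
- by move=> k km; exact: (du k.+1).
Qed.

End CircintPartsIter.

Section Pairing.
Variables (R : realType) (q : nat).
Implicit Types (f g : R -> R) (l : seq (R * R * R)).

(* The integral of f^(q) phi over a period, with the derivatives thrown on the test function. *)
Definition pairing f l : R :=
  (-1) ^+ q * circint (fun t => f t * cosum (iter q (@dcosum R) l) t).

Lemma pairing_cosum m1 m2 lT l : half_degree (2 * m1) lT -> half_degree (2 * m2) l ->
  pairing (cosum lT) l = circint (fun t => cosum (iter q (@dcosum R) lT) t * cosum l t).
Proof.
move=> h1 h2; rewrite /pairing.
rewrite (@circint_parts_iter _ q (fun k => cosum (iter k (@dcosum R) lT))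
   (fun k => cosum (iter k (@dcosum R) l))).
- by rewrite mulrA -expr2 -exprM mulnC exprM sqrrN expr1n expr1n mul1r.
- by move=> k _; apply: (cosum_periodic (m := m1)); exact: half_degree_dcosum.
- by move=> k; apply: (cosum_periodic (m := m2)); exact: half_degree_dcosum.
- by move=> k _; exact: cosum_continuous.
- by move=> k; exact: cosum_continuous.
- by move=> k _; exact: cosum_primitive.
- by move=> k; exact: cosum_primitive.
Qed.

Lemma pairing_continuous f l : continuous f ->
  continuous (fun t => f t * cosum (iter q (@dcosum R) l) t).
Proof. by move=> cf; apply: continuous_mul => //; exact: cosum_continuous. Qed.

Lemma pairing_add f g l : continuous f -> continuous g ->
  pairing (fun t => f t + g t) l = pairing f l + pairing g l.
Proof.
move=> cf cg; rewrite /pairing -mulrDr -circintD; [|exact: pairing_continuous..].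
by congr (_ * circint _); apply/funext => t; rewrite mulrDl.
Qed.

Lemma pairing_scale c f l : continuous f -> pairing (fun t => c * f t) l = c * pairing f l.
Proof.
move=> cf; rewrite /pairing mulrCA -[c * circint _]circintZ; last exact: pairing_continuous.
by congr (_ * circint _); apply/funext => t; rewrite mulrA.
Qed.

Lemma norm_pairing_le m f l e : half_degree (2 * m) l -> continuous f -> periodic2pi f ->
  (forall t, `|f t| <= e) -> `|pairing f l| <= 2 * pi * (e * (m%:R ^+ q * amplitude l)).
Proof.
move=> h cf pf fe; rewrite normrM normrX normrN1 expr1n mul1r.
have hq := half_degree_dcosum (k := q) h.
apply: circint_norm_le; last first.
- move=> t; rewrite normrM; apply: ler_pM => //.
  apply: (le_trans (norm_cosum_le _ _)).
  have := @amplitude_iter_dcosum _ _ _ q h.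
  by rewrite natrM mulrAC mulfV ?pnatr_eq0// mul1r.
- exact: pairing_continuous.
- by move=> t; rewrite pf (cosum_periodic hq).
Qed.

End Pairing.

(** * The test waves and the inequality that constrains approximants *)

Section TestWaves.
Variables (R : realType) (q s : nat) (y : nat -> R).
Hypothesis (q3 : (3 <= q)%N) (s1 : (1 <= s)%N).
Hypothesis y_decr : forall i : nat, (1 <= i < 2 * s)%N -> y i.+1 < y i.
Hypothesis y_period : y 1%N < y (2 * s)%N + 2 * pi.
Implicit Types (t al : R) (N : nat).

(** Phases [al] for which cos (t/2 + al) runs through sin ((t - y_i)/2), i >= 2, and then 2N times
    through cos ((t - y_1)/2). Their number is odd, so that one more head factor makes the product 2
    pi-periodic. *)
Definition tail_phases N : seq R :=
  [seq - (y i / 2) - pi / 2 | i <- index_iota 2 (2 * s).+1] ++ nseq (2 * N) (- (y 1%N / 2)).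

Definition tail_wave N t : R := \prod_(al <- tail_phases N) cos (t / 2 + al).

Definition test_wave N al := mul_halves (al :: tail_phases N) [:: (1 : R, 0 : R, 0 : R)].

(* phi1 has the sign pattern of Delta; phi0 differs from it by the factor cot ((t - y 1) / 2). *)
Definition phi1 N := test_wave N (- (y 1%N / 2) - pi / 2).
Definition phi0 N := test_wave N (- (y 1%N / 2)).

Lemma size_tail_phases N : (size (tail_phases N)).+1 = (2 * (s + N))%N.
Proof. by rewrite size_cat size_map size_iota size_nseq; move: s1; clear; lia. Qed.

Lemma half_degree_mul_tail m N al l : half_degree (2 * m) l ->
  half_degree (2 * (m + s + N)) (mul_halves (al :: tail_phases N) l).
Proof.
move=> /(half_degree_mul_halves (als := al :: tail_phases N)).
by rewrite /= size_tail_phases -mulnDr addnC addnA.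
Qed.

Lemma half_degree_unit : half_degree (2 * 0) [:: (1 : R, 0 : R, 0 : R)].
Proof. by move=> p; rewrite inE => /eqP -> /=; exists 0%N => //; rewrite mul0r subr0. Qed.

Lemma half_degree_test N al : half_degree (2 * (s + N)) (test_wave N al).
Proof. exact: (half_degree_mul_tail (m := 0)) half_degree_unit. Qed.

Lemma amplitude_test N al : amplitude (test_wave N al) = 1.
Proof. by rewrite amplitude_mul_halves /amplitude big_seq1 /= normr1. Qed.

Lemma cosum_mul_tail N al l t :
  cosum (mul_halves (al :: tail_phases N) l) t = cosum l t * (cos (t / 2 + al) * tail_wave N t).
Proof. by rewrite cosum_mul_halves big_cons. Qed.

Lemma test_waveE N al t : cosum (test_wave N al) t = cos (t / 2 + al) * tail_wave N t.
Proof.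
by rewrite cosum_mul_tail /cosum big_seq1 /= mul0r addr0 cos0 mulr1 mul1r.
Qed.

Lemma cos_phase t i : cos (t / 2 + (- (y i / 2) - pi / 2)) = sin ((t - y i) / 2).
Proof. by rewrite addrA cosBpihalf; congr sin; ring. Qed.

Lemma tail_waveE N t : tail_wave N t =
  (\prod_(2 <= i < (2 * s).+1) sin ((t - y i) / 2)) * cos ((t - y 1%N) / 2) ^+ (2 * N).
Proof.
rewrite /tail_wave /tail_phases big_cat big_map /=; congr (_ * _).
  by apply: eq_bigr => i _; rewrite cos_phase.
rewrite big_nseq; elim: (2 * N)%N => [//|k IH]; rewrite exprS /= -{}IH.
by congr (cos _ * _); ring.
Qed.

Lemma phi1E N t : cosum (phi1 N) t = sin ((t - y 1%N) / 2) * tail_wave N t.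
Proof. by rewrite test_waveE cos_phase. Qed.

Lemma phi0E N t : cosum (phi0 N) t = cos ((t - y 1%N) / 2) * tail_wave N t.
Proof. by rewrite test_waveE; congr (cos _ * _); ring. Qed.

Lemma phi1_sines N t : cosum (phi1 N) t = knot_sines s y t * cos ((t - y 1%N) / 2) ^+ (2 * N).
Proof. by rewrite phi1E tail_waveE mulrA /knot_sines [in RHS]big_ltn//; move: s1; clear; lia. Qed.

Lemma cos_even_pow_ge0 (N : nat) t : 0 <= cos t ^+ (2 * N) :> R.
Proof. by rewrite exprM exprn_ge0// sqr_ge0. Qed.

Lemma circint_phi1_ge0 l n N : half_degree (2 * n) l -> Delta q y s (cosum l) ->
  0 <= circint (fun t => cosum (iter q (@dcosum R) l) t * cosum (phi1 N) t).
Proof.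
move=> hl Dl; apply: (@circint_ge0 _ _ (y (2 * s)%N)).
- move=> t; have hd := half_degree_dcosum (k := q) hl.
  rewrite (cosum_periodic hd) (cosum_periodic (m := s + N))//.
  exact: half_degree_test.
- by apply: continuous_mul; exact: cosum_continuous.
- move=> t tP; rewrite phi1_sines mulrA; apply: mulr_ge0; last exact: cos_even_pow_ge0.
  exact: (Delta_sign q3 s1 y_decr y_period).
Qed.

(** The ratio of [phi0] to [phi1] has a pole at y_1. Since T has finite degree, 1 can be replaced by
    1 - cos (K (t - y_1)) under the integral, and this factor removes the pole at the price 2K. *)
Lemma circint_phi0_le l n N : half_degree (2 * n) l -> Delta q y s (cosum l) ->
  circint (fun t => cosum (iter q (@dcosum R) l) t * cosum (phi0 N) t) <=
  2 * (n + s + N).+1%:R * circint (fun t => cosum (iter q (@dcosum R) l) t * cosum (phi1 N) t).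
Proof.
(* The product T^(q) [phi0] has degree at most n + s + N; K is one more, so that [cosum_orthogonal]
   applies. *)
move=> hl Dl; set K := (n + s + N).+1; set S := iter q (@dcosum R) l.
have hS : half_degree (2 * n) S by exact: half_degree_dcosum.
have pS := cosum_periodic hS.
have p1 : periodic2pi (cosum (phi1 N)).
  exact: (cosum_periodic (m := s + N)) (@half_degree_test _ _).
have p0 : periodic2pi (cosum (phi0 N)).
  exact: (cosum_periodic (m := s + N)) (@half_degree_test _ _).
have cc := @cosum_continuous R.
pose w t : R := cos (K%:R * t + - (K%:R * y 1%N)).
have orth : circint (fun t => (cosum S t * cosum (phi0 N) t) * w t) = 0.
  rewrite -(@cosum_orthogonal R (n + s + N) (mul_halves (- (y 1%N / 2) :: tail_phases N) S)
    K (- (K%:R * y 1%N))) //; last exact: half_degree_mul_tail.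
  congr circint; apply/funext => t; congr (_ * _).
  by rewrite /phi0 test_waveE cosum_mul_tail.
have cw : continuous w by exact: cos_affine_continuous.
have c0 : continuous (fun t => cosum S t * cosum (phi0 N) t) by exact: continuous_mul.
have c1 : continuous (fun t => cosum S t * cosum (phi1 N) t) by exact: continuous_mul.
have c0w := continuous_mul c0 cw.
rewrite -[leLHS]subr0 -{1}orth -circintB// -circintZ// -subr_ge0 -circintB; first last.
- exact: continuous_sub.
- exact: continuous_scale.
apply: (@circint_ge0 _ _ (y (2 * s)%N)).
- move=> t; rewrite pS p0 p1 (_ : w (t + 2 * pi) = w t)//.
  rewrite -[RHS](@cos_periodic_nat R _ K 0) subr0 /w; congr cos; ring.
- exact/continuous_sub/continuous_sub/c0w/c0/continuous_scale.
move=> t /(Delta_sign q3 s1 y_decr y_period Dl) pos.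
set x := t - y 1%N; pose sg := cosum S t * tail_wave N t.
have wE : w t = cos (K%:R * x) by rewrite /w /x; congr cos; ring.
have S1 : cosum S t * cosum (phi1 N) t = sg * sin (x / 2) by rewrite phi1E /sg; ring.
have S0 : cosum S t * cosum (phi0 N) t = sg * cos (x / 2) by rewrite phi0E /sg; ring.
have pos1 : 0 <= sg * sin (x / 2).
  by rewrite -S1 phi1_sines mulrA; apply: mulr_ge0 => //; exact: cos_even_pow_ge0.
rewrite S0 S1 wE subr_ge0 -{1}[sg * cos _]mulr1 -mulrBr.
have /andP[k0 k1] := one_sub_cos_le K x.
(* The sign of [sg * cos (x / 2)] is unknown, hence absolute values; by [pos1] those on the right
   change nothing. *)
apply: (le_trans (ler_norm _)); rewrite -(ger0_norm pos1) !normrM (ger0_norm k0).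
rewrite mulrCA -[leLHS]mulrA; apply: ler_wpM2l => //.
by apply: le_trans k1; rewrite ler_piMl// cos_max.
Qed.

Lemma pairing_error f T e N al : continuous f -> periodic2pi f -> continuous T -> periodic2pi T ->
  (forall t, `|f t - T t| <= e) ->
  `|pairing q f (test_wave N al) - pairing q T (test_wave N al)| <= 2 * pi * (e * (s + N)%:R ^+ q).
Proof.
move=> cf pf cT pT fT.
have -> : pairing q f (test_wave N al) - pairing q T (test_wave N al) =
    pairing q (fun t => f t + (-1) * T t) (test_wave N al).
  by rewrite pairing_add ?pairing_scale ?mulN1r//; exact: continuous_scale.
have cg : continuous (fun t => f t + (-1) * T t).
  by apply: continuous_add => //; exact: continuous_scale.
have pg : periodic2pi (fun t => f t + (-1) * T t) by move=> t; rewrite pf pT.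
have := @norm_pairing_le R q _ _ _ e (@half_degree_test N al) cg pg.
rewrite amplitude_test mulr1; apply => t; by rewrite mulN1r.
Qed.

Lemma pairing_phi1_lower f n T e N : continuous f -> periodic2pi f ->
  trig_poly n T -> Delta q y s T -> (forall t, `|f t - T t| <= e) ->
  - (2 * pi * (e * (s + N)%:R ^+ q)) <= pairing q f (phi1 N).
Proof.
move=> cf pf /trig_poly_cosum[l hl ->] Dl fT.
have := pairing_error N (- (y 1%N / 2) - pi / 2) cf pf (@cosum_continuous R l)
  (cosum_periodic hl) fT.
rewrite -/(phi1 N) (pairing_cosum _ hl (@half_degree_test N _)).
have := circint_phi1_ge0 N hl Dl.
by rewrite ler_norml => ? /andP[? ?]; lra.
Qed.

(** Replacing T by f moves each pairing by at most d = 2 pi e (s + N)^q. This error enters once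
    through [phi0] and 2K times through [phi1]. *)
Lemma pairing_phi0_le f n T e N : continuous f -> periodic2pi f ->
  trig_poly n T -> Delta q y s T -> (forall t, `|f t - T t| <= e) ->
  pairing q f (phi0 N) <= 2 * (n + s + N).+1%:R * pairing q f (phi1 N) +
    (2 * (n + s + N).+1%:R + 1) * (2 * pi * (e * (s + N)%:R ^+ q)).
Proof.
move=> cf pf /trig_poly_cosum[l hl ->] Dl fT.
have E al := pairing_error N al cf pf (@cosum_continuous R l) (cosum_periodic hl) fT.
have := E (- (y 1%N / 2)); have := E (- (y 1%N / 2) - pi / 2).
rewrite -/(phi1 N) -/(phi0 N) !(pairing_cosum _ hl (@half_degree_test N _)).
have := circint_phi0_le N hl Dl.
set A0 := circint _; set A1 := circint _; set d := 2 * pi * _; set K := 2 * _.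
move=> h0 h1 h2.
have h3 : K * (A1 - pairing q f (phi1 N)) <= K * d.
  by apply: ler_wpM2l; [exact: mulr_ge0|move: h1; rewrite ler_norml => /andP[]; lra].
move: h2; rewrite ler_norml => /andP[? ?]; lra.
Qed.

End TestWaves.

(** * Chains of successive derivatives with uniform Taylor remainders *)

Section SmoothChains.
Variable R : realType.
Implicit Types (f g : R -> R) (G : nat -> R -> R) (x t u d h L C : R) (k m : nat).

Lemma is_derive_quadratic f x d C :
  (forall u, `|f (x + u) - f x - u * d| <= C * u ^+ 2) -> is_derive x 1 f d.
Proof.
move=> H.
have C0 : 0 <= C by have := le_trans (normr_ge0 _) (H 1); rewrite expr1n mulr1.
suff h : (fun u : R => u^-1 *: ((f \o shift x) (u *: (1 : R)) - f x)) @ 0^' --> d.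
  by split; [exact: cvgP h|exact: cvg_lim h].
apply/cvgrPdist_le => e e0; near=> u.
have u0 : u != 0 by near: u; exact: nbhs_dnbhs_neq.
have ue : `|u| <= e / (C + 1).
  near: u; apply: dnbhs0_le; apply: divr_gt0 => //; lra.
have -> : d - u^-1 *: ((f \o shift x) (u *: 1) - f x) = - (u^-1 * (f (x + u) - f x - u * d)).
  rewrite /= /shift /= (_ : u *: 1 + x = x + u); last by rewrite addrC /GRing.scale /= mulr1.
  by rewrite /GRing.scale /=; field.
rewrite normrN normrM normfV.
apply: (@le_trans _ _ (`|u|^-1 * (C * u ^+ 2))); first by rewrite ler_wpM2l// invr_ge0.
rewrite -(real_normK (num_real u)) (_ : `|u|^-1 * (C * `|u| ^+ 2) = C * `|u|); last first.
  by field; rewrite normr_eq0.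
apply: (@le_trans _ _ ((C + 1) * `|u|)); first by rewrite ler_wpM2r//; lra.
by rewrite mulrC -ler_pdivlMr//; lra.
Unshelve. all: by end_near.
Qed.

(* G k.+1 is the derivative of G k for k < m; the second-order remainder estimate makes the notion
   stable under pointwise limits with a fixed constant. *)
Definition smooth_chain m L G :=
  [/\ forall k, (k <= m)%N -> periodic2pi (G k),
      forall k x, (k <= m)%N -> `|G k x| <= L,
      forall k x u, (k <= m)%N -> `|G k (x + u) - G k x| <= L * `|u| &
      forall k x u, (k < m)%N -> `|G k (x + u) - G k x - u * G k.+1 x| <= L * u ^+ 2].

Lemma smooth_chain_primitive m L G k : smooth_chain m L G -> (k < m)%N ->
  primitive (G k) (G k.+1).
Proof. by move=> [_ _ _ h] km x; apply: (@is_derive_quadratic _ _ _ L) => u; exact: h. Qed.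

Lemma lipschitz_continuous g L :
  (forall x u, `|g (x + u) - g x| <= L * `|u|) -> continuous g.
Proof.
move=> H x; have L0 : 0 <= L.
  by have := le_trans (normr_ge0 _) (H 0 1); rewrite normr1 mulr1.
apply/cvgrPdist_le => e e0; near=> z.
have Hz := H x (z - x); rewrite (addrC x) subrK in Hz; rewrite distrC (le_trans Hz)//.
have : `|z - x| <= e / (L + 1).
  by rewrite distrC; near: z; apply: cvgr_dist_le => //; apply: divr_gt0 => //; lra.
rewrite ler_pdivlMr; last lra.
by move=> zx; apply: le_trans zx; rewrite mulrC ler_wpM2l//; lra.
Unshelve. all: by end_near.
Qed.

Lemma smooth_chain_continuous m L G k : smooth_chain m L G -> (k <= m)%N -> continuous (G k).
Proof. by move=> [_ _ h _] km; apply: (@lipschitz_continuous _ L) => x u; exact: h. Qed.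

Lemma smooth_chain_ge0 m L G : smooth_chain m L G -> 0 <= L.
Proof. by move=> [_ h _ _]; exact: le_trans (normr_ge0 _) (h 0%N 0 (leq0n _)). Qed.

Lemma smooth_chain_add m L1 L2 G1 G2 : smooth_chain m L1 G1 -> smooth_chain m L2 G2 ->
  smooth_chain m (L1 + L2) (fun k x => G1 k x + G2 k x).
Proof.
move=> [p1 b1 l1 q1] [p2 b2 l2 q2]; split.
- by move=> k km x; rewrite p1// p2.
- by move=> k x km; rewrite (le_trans (ler_normD _ _))// lerD ?b1 ?b2.
- move=> k x u km; rewrite mulrDl; apply: (le_trans _ (lerD (l1 k x u km) (l2 k x u km))).
  by apply: le_trans (ler_normD _ _); rewrite le_eqVlt; apply/orP; left; apply/eqP; congr `|_|; ring.
- move=> k x u km; rewrite mulrDl; apply: (le_trans _ (lerD (q1 k x u km) (q2 k x u km))).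
  by apply: le_trans (ler_normD _ _); rewrite le_eqVlt; apply/orP; left; apply/eqP; congr `|_|; ring.
Qed.

Lemma smooth_chain_scale m L G c : smooth_chain m L G ->
  smooth_chain m (`|c| * L) (fun k x => c * G k x).
Proof.
move=> [p1 b1 l1 q1]; split.
- by move=> k km x; rewrite p1.
- by move=> k x km; rewrite normrM ler_wpM2l// b1.
- by move=> k x u km; rewrite -mulrBr normrM -mulrA ler_wpM2l// l1.
- move=> k x u km.
  have -> : c * G k (x + u) - c * G k x - u * (c * G k.+1 x) =
    c * (G k (x + u) - G k x - u * G k.+1 x) by ring.
  by rewrite normrM -mulrA ler_wpM2l// q1.
Qed.

Lemma smooth_chain_shift m L G s : smooth_chain m L G ->
  smooth_chain m L (fun k x => G k (x + s)).
Proof.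
move=> [p1 b1 l1 q1]; split.
- by move=> k km x; rewrite addrAC p1.
- by move=> k x km; exact: b1.
- by move=> k x u km; rewrite (addrAC x); exact: l1.
- by move=> k x u km; rewrite (addrAC x); exact: q1.
Qed.

Lemma smooth_chain_cst m L : 0 <= L -> smooth_chain m L (fun _ _ => 0).
Proof.
by move=> L0; split => [k km x|k x km|k x u km|k x u km];
  rewrite ?mulr0 ?subr0 ?normr0//; apply: mulr_ge0 => //; exact: sqr_ge0.
Qed.

Lemma smooth_chain_le m L L' G : L <= L' -> smooth_chain m L G -> smooth_chain m L' G.
Proof.
move=> LL [p1 b1 l1 q1]; split => //.
- by move=> k x km; apply: le_trans LL; exact: b1.
- by move=> k x u km; apply: (le_trans (l1 k x u km)); rewrite ler_wpM2r.
- by move=> k x u km; apply: (le_trans (q1 k x u km)); rewrite ler_wpM2r// sqr_ge0.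
Qed.

(** The divisor is 2 rather than h so that the chain constant is preserved for every h; the price is
    the factor (h/2)^p in the pairings. *)
Definition half_diff h g x : R := (g x - g (x - h)) / 2.

Lemma smooth_chain_half_diff m L G h : smooth_chain m L G ->
  smooth_chain m L (fun k => half_diff h (G k)).
Proof.
move=> H.
have H1 := smooth_chain_scale (2^-1) H.
have H2 := smooth_chain_scale (- 2^-1) (smooth_chain_shift (- h) H).
have := smooth_chain_add H1 H2.
rewrite (_ : _ + _ = L); last by rewrite normrN ger0_norm ?invr_ge0//; field.
congr smooth_chain; apply/funext => k; apply/funext => x.
by rewrite /half_diff; field.
Qed.

Lemma smooth_chain_iter_half_diff m L G h p : smooth_chain m L G ->
  smooth_chain m L (fun k => iter p (half_diff h) (G k)).
Proof. by move=> H; elim: p => [//|p IH]; exact: smooth_chain_half_diff IH. Qed.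

Lemma le_of_small x C : (forall e, 0 < e -> x <= C + e) -> x <= C.
Proof.
by move=> H; rewrite leNgt; apply/negP => h; have := H ((x - C) / 2) ltac:(lra); lra.
Qed.

(** Each clause involves finitely many point values with a fixed constant, so it is closed under
    uniform limits; no convergence theorem for derivatives is invoked. *)
Lemma smooth_chain_limit m L G (H : nat -> nat -> R -> R) (d : nat -> R) :
  (forall j, smooth_chain m L (H j)) ->
  (forall j k x, (k <= m)%N -> `|G k x - H j k x| <= d j) ->
  (forall e, 0 < e -> exists j, d j < e) -> smooth_chain m L G.
Proof.
move=> sH GH d0.
have near_j e : 0 < e -> exists j, forall k x, (k <= m)%N -> - e <= G k x - H j k x <= e.
  move=> e0; have [j dj] := d0 e e0; exists j => k x km.
  by rewrite -ler_norml (le_trans (GH j k x km))// ltW.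
split.
- move=> k km x; apply/eqP; rewrite eq_le; apply/andP; split; apply: le_of_small => e e0;
  have [j hj] := near_j (e / 2) ltac:(lra); have [p _ _ _] := sH j;
  have := p k km x; have /andP[] := hj k x km; have /andP[] := hj k (x + 2 * pi) km; lra.
- move=> k x km; apply: le_of_small => e e0; have [j hj] := near_j e e0.
  have [_ b _ _] := sH j; have := b k x km; rewrite !ler_norml => /andP[b1 b2].
  by have /andP[? ?] := hj k x km; lra.
- move=> k x u km; apply: le_of_small => e e0; have [j hj] := near_j (e / 2) ltac:(lra).
  have [_ _ l _] := sH j; have := l k x u km; rewrite !ler_norml => /andP[b1 b2].
  by have /andP[? ?] := hj k x km; have /andP[? ?] := hj k (x + u) km; lra.
- move=> k x u km; apply: le_of_small => e e0.
  (* The remainder contains two values of [G k] with weight 1 and one of [G k.+1] with weight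
     |u|. *)
  have [j hj] := near_j (e / (2 + `|u|)) ltac:(by apply: divr_gt0 => //; have := normr_ge0 u; lra).
  have [_ _ _ l] := sH j; have lj := l k x u km.
  have -> : G k (x + u) - G k x - u * G k.+1 x =
    (H j k (x + u) - H j k x - u * H j k.+1 x) +
    ((G k (x + u) - H j k (x + u)) - (G k x - H j k x) - u * (G k.+1 x - H j k.+1 x)) by ring.
  apply: (le_trans (ler_normD _ _)); apply: lerD => //.
  set e' := e / _ in hj; have eE : e = e' + e' + `|u| * e'.
    by rewrite /e'; field; have := normr_ge0 u; apply: contraTneq => h; lra.
  rewrite eE; apply: (le_trans (ler_normB _ _)); apply: lerD; last first.
    by rewrite normrM ler_wpM2l// ler_norml hj.
  apply: (le_trans (ler_normB _ _)); apply: lerD; rewrite ler_norml hj//; exact: ltnW.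
Qed.

End SmoothChains.

(** * The periodic parabola and repeated mean-zero integration *)

Section PeriodicParabola.
Variable R : realType.
Implicit Types (f g : R -> R) (x t u a L : R) (m : nat).

Lemma periodic_int g x (k : int) : periodic2pi g -> g (x + k%:~R * (2 * pi)) = g x.
Proof.
move=> pg; have H (n : nat) z : g (z + n%:R * (2 * pi)) = g z.
  elim: n z => [|n IH] z; first by rewrite mul0r addr0.
  by rewrite -natr1 mulrDl mul1r addrA pg IH.
case: k => n; first exact: H.
rewrite NegzE -[LHS](H n.+1); congr g.
by rewrite mulrNz mulNr addrNK.
Qed.

Lemma period_representative a x : exists k : int, a <= x + k%:~R * (2 * pi) < a + 2 * pi.
Proof.
have P := pi2_gt0 R.
exists (- Num.floor ((x - a) / (2 * pi))).
have := floor_itv ((x - a) / (2 * pi)); set k := Num.floor _.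
rewrite ler_pdivlMr// ltr_pdivrMr// intrD mulrNz mulrDl mul1r mulNr.
by move=> /andP[? ?]; lra.
Qed.

(** Up to an affine change of the value this is the periodic Bernoulli function of degree 2. It has
    a convex kink at the multiples of 2 pi. *)
Definition parabola x : R :=
  let th := x - (Num.floor (x / (2 * pi)))%:~R * (2 * pi) in th * (2 * pi - th).

Lemma parabola_periodic : periodic2pi parabola.
Proof.
move=> x; have P := pi2_gt0 R; rewrite /parabola.
have -> : (x + 2 * pi) / (2 * pi) = x / (2 * pi) + 1 by rewrite mulrDl mulfV ?gt_eqF.
by rewrite floorDrz ?rpred1// floor1 intrD; ring.
Qed.

Lemma parabola_right x : 0 <= x <= 2 * pi -> parabola x = x * (2 * pi - x).
Proof.
have P := pi2_gt0 R; move=> /andP[x0]; rewrite le_eqVlt => /orP[/eqP -> |x1].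
  rewrite -[2 * pi in LHS]add0r parabola_periodic subrr mulr0.
  by rewrite /parabola mul0r floor0 mul0r subr0 mul0r.
rewrite /parabola (@floor_def _ _ 0) ?mul0r ?subr0//.
by rewrite add0r divr_ge0 ?(ltW P)//= ltr_pdivrMr// mul1r.
Qed.

Lemma parabolaE x : - (2 * pi) <= x <= 2 * pi -> parabola x = 2 * pi * `|x| - x ^+ 2.
Proof.
move=> /andP[x1 x2]; have [x0|x0] := leP 0 x.
  by rewrite parabola_right ?x0// ger0_norm//; ring.
by rewrite -parabola_periodic parabola_right ?ltr0_norm//; [ring|lra].
Qed.

Lemma parabola_bound x : 0 <= parabola x <= 4 * pi ^+ 2.
Proof.
have [k /andP[]] := period_representative 0 x; rewrite -(periodic_int x k parabola_periodic).
set z := x + _ => z0 z1; rewrite parabola_right; last lra.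
rewrite add0r in z1.
have P := pi2_gt0 R; apply/andP; split; first by apply: mulr_ge0; lra.
rewrite (_ : 4 * pi ^+ 2 = 2 * pi * (2 * pi)); last by ring.
by apply: ler_pM; lra.
Qed.

(** For |u| >= pi the range 4 pi^2 suffices. Otherwise x is moved to z in [-pi, pi), the kink
    contributes 2 pi, and |2z + u| <= 3 pi accounts for the square. *)
Lemma parabola_lipschitz x u : `|parabola (x + u) - parabola x| <= 5 * pi * `|u|.
Proof.
have P := pi_gt0 R.
have [u1|u1] := leP pi `|u|.
  have /andP[a1 a2] := parabola_bound x; have /andP[b1 b2] := parabola_bound (x + u).
  have : 5 * pi * pi <= 5 * pi * `|u| by apply: ler_wpM2l => //; lra.
  have : 0 < pi * pi :> R by exact: mulr_gt0.
  by rewrite expr2 in a2 b2; rewrite ler_norml => ? ?; apply/andP; split; lra.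
have [k /andP[]] := period_representative (- pi) x.
rewrite -(periodic_int x k parabola_periodic) -(periodic_int (x + u) k parabola_periodic).
rewrite addrAC; set z := x + _ => z0 z1; move: u1; rewrite ltr_norml => /andP[u1 u2].
rewrite !parabolaE; try lra.
have -> : 2 * pi * `|z + u| - (z + u) ^+ 2 - (2 * pi * `|z| - z ^+ 2) =
  2 * pi * (`|z + u| - `|z|) - u * (2 * z + u) by ring.
apply: (le_trans (ler_normB _ _)).
rewrite (_ : 5 * pi * `|u| = 2 * pi * `|u| + `|u| * (3 * pi)); last by ring.
apply: lerD; rewrite normrM.
  rewrite (ger0_norm (x := 2 * pi)); last lra.
  apply: ler_wpM2l; first lra.
  by have := lerB_dist (z + u) z; have := ler_dist_dist (z + u) z; rewrite (addrAC z) subrr add0r.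
by apply: ler_wpM2l => //; rewrite ler_norml; apply/andP; split; lra.
Qed.

Lemma parabola_continuous : continuous parabola.
Proof. by apply: lipschitz_continuous => x u; exact: parabola_lipschitz. Qed.

(* The second derivative of the parabola is 4 pi delta_0 - 2 on the circle. *)
Lemma circint_parabola m l x : half_degree (2 * m) l ->
  circint (fun t => parabola (t - x) * cosum (iter 2 (@dcosum R) l) t) =
  4 * pi * cosum l x - 2 * circint (cosum l).
Proof.
move=> hl; have pl := cosum_periodic hl; have cl := @cosum_continuous R l.
have P := pi2_gt0 R.
pose ph := cosum l; pose ph1 := cosum (dcosum l); pose Ph := prim ph.
(* Two integrations by parts with the quadratic P = (t - x)(2 pi - (t - x)): F = P ph' - P' ph + P''
   Ph. P vanishes at both ends, and P' = 2 pi, -2 pi there yields the term 4 pi. *)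
pose F t := ((1 * t + - x) * (-1 * t + (2 * pi + x))) * ph1 t
            - (-2 * t + (2 * pi + 2 * x)) * ph t - 2 * Ph t.
have dF t : is_derive t 1 F ((t - x) * (2 * pi - (t - x)) * cosum (iter 2 (@dcosum R) l) t).
  have d1 := is_derive_mul (is_derive_affine 1 (- x) t) (is_derive_affine (-1) (2 * pi + x) t).
  have d2 := is_derive_mul d1 (@cosum_primitive R (dcosum l) t).
  have d3 := is_derive_mul (is_derive_affine (-2) (2 * pi + 2 * x) t) (@cosum_primitive R l t).
  have d4 := is_derive_scale 2 (primP cl t).
  apply: is_derive_eq (is_derive_sub (is_derive_sub d2 d3) d4) _.
  by rewrite /=; ring.
transitivity (F (x + 2 * pi) - F x); last first.
  rewrite (circint_shift_prim x pl cl (primP cl)) /F /ph /ph1 /Ph !pl.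
  by rewrite (cosum_periodic (half_degree_dcosum (k := 1) hl)); ring.
apply: circint_on.
- by move=> t; rewrite addrAC parabola_periodic (cosum_periodic (half_degree_dcosum (k := 2) hl)).
- apply: continuous_mul; last exact: cosum_continuous.
  exact: (@continuous_translate R parabola (- x) parabola_continuous).
- by move=> t; exact: is_derive_continuous (dF t).
- by move=> t /andP[t1 t2]; rewrite parabola_right; [exact: dF|lra].
Qed.

(** Mean zero makes the primitive periodic, and subtracting its own mean restores the hypothesis for
    the next integration; this is why the conclusion records [circint (U 0%N) = 0]. *)
Lemma exists_smooth_chain g L m : periodic2pi g ->
  (forall x u, `|g (x + u) - g x| <= L * `|u|) -> circint g = 0 ->
  exists L' (U : nat -> R -> R), [/\ smooth_chain m L' U, U m = g & circint (U 0%N) = 0].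
Proof.
move=> pg lg g0; have L0 : 0 <= L.
  by have := le_trans (normr_ge0 _) (lg 0 1); rewrite normr1 mulr1.
have bound f C : periodic2pi f -> (forall x u, `|f (x + u) - f x| <= C * `|u|) -> 0 <= C ->
    forall x, `|f x| <= `|f 0| + C * (2 * pi).
  move=> pf lf C0 x; have [k] := period_representative 0 x.
  rewrite -(periodic_int x k pf); set z := x + _ => /andP[z0 z1].
  rewrite -lerBlDl (le_trans (lerB_dist _ _))//.
  have := lf 0 z; rewrite add0r => /le_trans; apply; apply: ler_wpM2l => //.
  by rewrite ger0_norm//; lra.
elim: m => [|m [C [U [sU Um U0]]]].
  exists (`|g 0| + L * (2 * pi) + L), (fun=> g); split => //; split => //.
  - by move=> k x _; apply: (le_trans (bound g L pg lg L0 x)); rewrite lerDl.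
  - move=> k x u _; apply: (le_trans (lg x u)); apply: ler_wpM2r => //; rewrite lerDr.
    by apply: addr_ge0 => //; apply: mulr_ge0 => //; exact: ltW (pi2_gt0 R).
have cU0 := smooth_chain_continuous sU (leq0n m).
have [pU bU lU qU] := sU; have C0 := smooth_chain_ge0 sU.
have dP := primP cU0; set P := prim (U 0%N) in dP.
have pP : periodic2pi P.
  move=> x; apply/eqP; rewrite -subr_eq0 -(@circint_shift_prim R (U 0%N) P x)// ?U0//.
  exact: pU.
have cP : continuous P by exact: primitive_continuous dP.
have mean_cont : continuous (fun _ : R => circint P / (2 * pi)) by exact: continuous_const.
pose V x := P x - circint P / (2 * pi).
have dV : primitive V (U 0%N).
  by move=> x; apply: is_derive_eq (is_derive_sub (dP x) (is_derive_cst _ x 1)) _; rewrite subr0.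
(* One intermediate point serves twice: the bound on [U 0] gives the Lipschitz clause, and its
   Lipschitz bound gives the quadratic remainder. *)
have MV x u : exists2 c, `|c - x| <= `|u| & V (x + u) - V x = U 0%N c * u.
  have [u0|u0] := leP 0 u.
    have [|c /andP[c1 c2] ->] := @primitive_MVT R V (U 0%N) x (x + u) _ dV; first by rewrite lerDl.
    by exists c; [rewrite (ger0_norm u0) ler_norml; apply/andP; split; lra|congr (_ * _); ring].
  have [|c /andP[c1 c2] e] := @primitive_MVT R V (U 0%N) (x + u) x _ dV.
    by rewrite gerDl ltW.
  exists c; first by rewrite (ltr0_norm u0) ler_norml; apply/andP; split; lra.
  by rewrite -[LHS]opprK opprB e; ring.
have lV x u : `|V (x + u) - V x| <= C * `|u|.
  by have [c _ ->] := MV x u; rewrite normrM ler_wpM2r// bU.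
have pV : periodic2pi V by move=> x; rewrite /V pP.
pose K := `|V 0| + C * (2 * pi) + C.
have K0 : 0 <= `|V 0| + C * (2 * pi).
  by apply: addr_ge0 => //; apply: mulr_ge0 => //; exact: ltW (pi2_gt0 R).
have KC : C <= K by rewrite /K lerDr.
have [pU' bU' lU' qU'] := smooth_chain_le KC sU.
exists K, (fun k => if k is k'.+1 then U k' else V); split => //; last first.
  rewrite circintB// circint_const mulrC mulfVK ?subrr// gt_eqF// pi2_gt0 //.
split.
- by case=> [|k] km //; exact: pU.
- case=> [|k] x km; last exact: bU'.
  by apply: (le_trans (bound V C pV lV C0 x)); rewrite lerDl.
- case=> [|k] x u km; last exact: lU'.
  by apply: (le_trans (lV x u)); rewrite ler_wpM2r.
- case=> [|k] x u km; last exact: qU'.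
  have [c cu ->] := MV x u.
  rewrite [u * _]mulrC -mulrBl normrM.
  have := lU 0%N x (c - x) (leq0n m); rewrite (addrC x) subrK => h.
  apply: (@le_trans _ _ ((C * `|u|) * `|u|)).
    by rewrite ler_wpM2r//; apply: (le_trans h); rewrite ler_wpM2l.
  by rewrite -mulrA -expr2 real_normK ?num_real// ler_wpM2r// sqr_ge0.
Qed.

End PeriodicParabola.

(** * Differences of chains: their effect on integrals and on convexity *)

Section ShiftedPairings.
Variable R : realType.
Implicit Types (f g u w : R -> R) (G U : nat -> R -> R) (x t h L C B : R) (k m p : nat).

(** Differentiation under the integral: the remainder estimate of the chain is uniform in t, so it
    integrates to a remainder estimate for the integral. *)
Lemma circint_shift_primitive m L G (psi : R -> R) B k : smooth_chain m L G ->
  continuous psi -> periodic2pi psi -> (forall t, `|psi t| <= B) -> (k < m)%N ->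
  primitive (fun x => circint (fun t => G k (t - x) * psi t))
            (fun x => - circint (fun t => G k.+1 (t - x) * psi t)).
Proof.
move=> sG cpsi ppsi Bpsi km x.
have [pG bG lG qG] := sG.
have cG j z : (j <= m)%N -> continuous (fun t => G j (t - z) * psi t).
  move=> jm; apply: continuous_mul => //.
  exact: (@continuous_translate R (G j) (- z) (smooth_chain_continuous sG jm)).
apply: (@is_derive_quadratic R _ x _ (2 * pi * (L * B))) => u.
have km' := ltnW km.
rewrite mulrN opprK -!circintZ; [|exact: cG..].
rewrite -circintB; [|exact: cG..].
rewrite -circintD; first last.
- exact/continuous_scale/cG.
- by apply: continuous_sub; exact: cG.
rewrite -mulrA (_ : L * B * u ^+ 2 = L * u ^+ 2 * B); last by ring.
apply: circint_norm_le.
- move=> t; rewrite ppsi; do ! rewrite (addrAC t (2 * pi)).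
  by rewrite !pG.
- apply: continuous_add; last exact/continuous_scale/cG.
  by apply: continuous_sub; exact: cG.
move=> t; have := qG k (t - x) (- u) km; rewrite sqrrN => h.
have -> : G k (t - (x + u)) * psi t - G k (t - x) * psi t + u * (G k.+1 (t - x) * psi t) =
  (G k (t - x + - u) - G k (t - x) - - u * G k.+1 (t - x)) * psi t.
  by rewrite (_ : t - x + - u = t - (x + u)); [ring|ring].
by rewrite normrM; apply: ler_pM.
Qed.

(** Mean value theorem for p-fold differences, applied to the integral as a function of the shift:
    every half-difference becomes h/2 times a derivative at a shift larger by at most h. *)
Lemma circint_iter_half_diff m L G (psi : R -> R) B h p k x : smooth_chain m L G ->
  continuous psi -> periodic2pi psi -> (forall t, `|psi t| <= B) -> (k + p <= m)%N -> 0 <= h ->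
  exists2 xi, x <= xi <= x + p%:R * h &
    circint (fun t => iter p (half_diff h) (G k) (t - x) * psi t) =
    (h / 2) ^+ p * circint (fun t => G (k + p)%N (t - xi) * psi t).
Proof.
move=> sG cpsi ppsi Bpsi + h0; elim: p k x => [|p IH] k x kp.
  by exists x; [rewrite mul0r addr0 lexx|rewrite mul1r addn0].
pose w j := iter p (half_diff h) (G j).
have sw : smooth_chain m L w by exact: smooth_chain_iter_half_diff.
have km : (k < m)%N by lia.
have dJ := circint_shift_primitive sw cpsi ppsi Bpsi km.
have [|xi1 /andP[x1 x2] e1] := @primitive_MVT R _ _ x (x + h) _ dJ; first by rewrite lerDl.
have [|xi /andP[y1 y2] e2] := IH k.+1 xi1; first by lia.
exists xi.
  apply/andP; split; first exact: le_trans y1.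
  by rewrite -natr1 mulrDl mul1r; apply: (le_trans y2); lra.
rewrite addnS -addSn exprS -mulrA -e2.
have cw z : continuous (fun t => w k (t - z) * psi t).
  apply: continuous_mul => //.
  exact: (@continuous_translate R (w k) (- z) (smooth_chain_continuous sw (ltnW km))).
transitivity (circint (fun t => 2^-1 * (w k (t - x) * psi t - w k (t - (x + h)) * psi t))).
  congr circint; apply/funext => t; rewrite iterS /half_diff -/(w k).
  by rewrite (_ : t - x - h = t - (x + h)); [field|ring].
rewrite circintZ; last by apply: continuous_sub; exact: cw.
rewrite circintB; [|exact: cw..].
by rewrite -[circint _ - _]opprB e1 -/(w k.+1); field.
Qed.

(** The difference averages [w] over [x - h, x], and averages of convex functions are convex; the
    interval shrinks by h on the left so that [w] is convex on the whole window. *)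
Lemma half_diff_convex u w h a b (sg : R) : 0 <= h -> primitive u w ->
  convex_on_open a b (fun x => sg * w x) ->
  convex_on_open (a + h) b (fun x => sg * half_diff h u x).
Proof.
move=> h0 uw cw x z t /andP[x1 x2] /andP[z1 z2] /andP[t0 t1].
have dr x' (v : R) : is_derive v 1 (fun v => u (-1 * v + x')) (- w (x' - v)).
  have := @uw (-1 * v + x') => d.
  apply: is_derive_eq (is_derive_chain (g := fun v => -1 * v + x') d (is_derive_affine (-1) x' v)) _.
  by rewrite mulrN1 mulN1r addrC.
pose zt := t * x + (1 - t) * z.
(* The Jensen defect of [sg * u] with all points moved left by v. Its derivative is minus the defect
   of [sg * w], so [psi h <= psi 0], which is convexity of the difference. *)
pose psi v := sg * (t * u (-1 * v + x) + (1 - t) * u (-1 * v + z) - u (-1 * v + zt)).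
have dpsi : primitive psi (fun v =>
    - (sg * (t * w (x - v) + (1 - t) * w (z - v) - w (zt - v)))).
  move=> v; apply: is_derive_eq (is_derive_scale _ (is_derive_sub (is_derive_add
    (is_derive_scale t (dr x v)) (is_derive_scale (1 - t) (dr z v))) (dr zt v))) _.
  by ring.
have [v /andP[v0 v1] e] := @primitive_MVT R _ _ 0 h h0 dpsi.
have := cw (x - v) (z - v) t ltac:(lra) ltac:(lra) ltac:(lra).
rewrite (_ : t * (x - v) + (1 - t) * (z - v) = zt - v); last by rewrite /zt; ring.
move=> ineq; rewrite -/zt.
have : psi h <= psi 0.
  rewrite -subr_le0 e subr0 mulNr oppr_le0 mulr_ge0//; lra.
rewrite /psi /half_diff !mulr0 !add0r !mulN1r !(addrC (- h)); lra.
Qed.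

Lemma iter_half_diff_convex m L U h a b (sg : R) p : smooth_chain m L U -> 0 <= h ->
  (p <= m)%N -> convex_on_open a b (fun x => sg * U m x) ->
  convex_on_open (a + p%:R * h) b (fun x => sg * iter p (half_diff h) (U (m - p)%N) x).
Proof.
move=> sU h0 + cU; elim: p => [|p IH] pm; first by rewrite mul0r addr0 subn0.
have := IH (ltnW pm) => cp.
rewrite -natr1 mulrDl mul1r addrA.
have -> : (fun x => sg * iter p.+1 (half_diff h) (U (m - p.+1)%N) x) =
   fun x => sg * half_diff h (iter p (half_diff h) (U (m - p.+1)%N)) x by [].
apply: (half_diff_convex h0 _ cp).
rewrite (_ : (m - p)%N = (m - p.+1).+1); last by lia.
apply: (smooth_chain_primitive (smooth_chain_iter_half_diff h p sU)); lia.
Qed.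

Lemma convex_translate g h a b : convex_on_open a b g ->
  convex_on_open (a + h) (b + h) (fun x => g (x - h)).
Proof.
move=> cg x z t /andP[x1 x2] /andP[z1 z2] tt.
have := cg (x - h) (z - h) t ltac:(lra) ltac:(lra) tt.
by rewrite (_ : t * (x - h) + (1 - t) * (z - h) = t * x + (1 - t) * z - h); last by ring.
Qed.

End ShiftedPairings.

(** * Humps with one convex and one concave kink *)

Section Kinks.
Variable R : realType.
Implicit Types (a b c x t h L xi sg : R) (U : nat -> R -> R) (k m p : nat).

(* Up to affine terms, a convex kink at c and a concave one at z. *)
Definition two_kinks c z t : R := parabola (t - c) - parabola (t - z).

Lemma two_kinks_periodic c z : periodic2pi (two_kinks c z).
Proof. by move=> t; rewrite /two_kinks !(addrAC t (2 * pi)) !parabola_periodic. Qed.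

Lemma two_kinks_lipschitz c z x u :
  `|two_kinks c z (x + u) - two_kinks c z x| <= 10 * pi * `|u|.
Proof.
rewrite /two_kinks !(addrAC x u).
have := parabola_lipschitz (x - c) u; have := parabola_lipschitz (x - z) u.
by rewrite !ler_norml => /andP[? ?] /andP[? ?]; apply/andP; split; lra.
Qed.

Lemma two_kinks_circint c z : circint (two_kinks c z) = 0.
Proof.
have pc := @parabola_continuous R; have pp := @parabola_periodic R.
rewrite /two_kinks circintB; [|exact: continuous_translate..].
by rewrite !circint_shift// subrr.
Qed.

(** The quadratic terms cancel, leaving a piecewise affine function on this range. To the right of z
    only the convex kink is met, to the left of c only the concave one, to the left of z none. *)
Lemma two_kinksE c z t : z <= c -> c - 2 * pi <= t <= z + 2 * pi ->
  two_kinks c z t = 2 * pi * (`|t - c| - `|t - z|) + (2 * (c - z) * t + (z ^+ 2 - c ^+ 2)).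
Proof. by move=> zc /andP[t1 t2]; rewrite /two_kinks !parabolaE; [ring|lra|lra]. Qed.

Lemma convex_combination_in a b x z t : a < x < b -> a < z < b -> 0 <= t <= 1 ->
  a < t * x + (1 - t) * z < b.
Proof.
move=> /andP[x1 x2] /andP[z1 z2] /andP[t0 t1].
have [->|t0'] := eqVneq t 0; first by apply/andP; split; lra.
have tp : 0 < t by rewrite lt_neqAle eq_sym t0'.
have h1 : t * a < t * x by rewrite ltr_pM2l.
have h2 : t * x < t * b by rewrite ltr_pM2l.
have h3 : (1 - t) * a <= (1 - t) * z by apply: ler_wpM2l; lra.
have h4 : (1 - t) * z <= (1 - t) * b by apply: ler_wpM2l; lra.
by apply/andP; split; lra.
Qed.

Lemma norm_convex_combination c x z t : 0 <= t <= 1 ->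
  `|t * x + (1 - t) * z - c| <= t * `|x - c| + (1 - t) * `|z - c|.
Proof.
move=> /andP[t0 t1].
rewrite (_ : t * x + (1 - t) * z - c = t * (x - c) + (1 - t) * (z - c)); last by ring.
by apply: (le_trans (ler_normD _ _)); rewrite !normrM (ger0_norm t0) (@ger0_norm _ (1 - t))//; lra.
Qed.

Lemma two_kinks_convex c z a b : z <= c -> z <= a -> c - 2 * pi <= a -> b <= z + 2 * pi ->
  convex_on_open a b (two_kinks c z).
Proof.
move=> zc za ca bz x w t xab wab t01.
have vab := convex_combination_in xab wab t01.
have N := norm_convex_combination c x w t01; set v := _ + _ in vab N *.
rewrite !two_kinksE //; try lra.
rewrite !(@ger0_norm _ (_ - z)); try lra.
have : 2 * pi * `|v - c| <= 2 * pi * (t * `|x - c| + (1 - t) * `|w - c|).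
  by apply: ler_wpM2l => //; exact: ltW (pi2_gt0 R).
rewrite /v; lra.
Qed.

Lemma two_kinks_concave c z a b : z <= c -> c - 2 * pi <= a -> b <= c -> b <= z + 2 * pi ->
  convex_on_open a b (fun x => -1 * two_kinks c z x).
Proof.
move=> zc ca bc bz x w t xab wab t01.
have vab := convex_combination_in xab wab t01.
have N := norm_convex_combination z x w t01; set v := _ + _ in vab N *.
rewrite !two_kinksE //; try lra.
rewrite !(@ler0_norm _ (_ - c)); try lra.
have : 2 * pi * `|v - z| <= 2 * pi * (t * `|x - z| + (1 - t) * `|w - z|).
  by apply: ler_wpM2l => //; exact: ltW (pi2_gt0 R).
rewrite /v; lra.
Qed.

Lemma two_kinks_affine c z a b sg : z <= c -> c - 2 * pi <= a -> b <= z ->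
  convex_on_open a b (fun x => sg * two_kinks c z x).
Proof.
move=> zc ca bz x w t xab wab t01.
have vab := convex_combination_in xab wab t01; set v := _ + _ in vab *.
have P := pi2_gt0 R.
rewrite !two_kinksE //; try lra.
rewrite !(@ler0_norm _ (_ - c)); try lra.
by rewrite !(@ler0_norm _ (_ - z)); try lra; rewrite /v; lra.
Qed.

(** The p differences localise p of the integrations that produced U. The extra shift keeps the
    positive mass at distance at least h from the kink point, on which the decay in N rests. *)
Definition bump U p h k x : R := iter p (half_diff h) (U k) (x - h).

Lemma bump_chain m L U p h : smooth_chain m L U -> smooth_chain m L (bump U p h).
Proof.
by move=> sU; exact: (smooth_chain_shift (- h) (smooth_chain_iter_half_diff h p sU)).
Qed.

(* The p-th difference of a p-fold primitive averages the kinks over [h, (p + 1) h]. *)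
Lemma pairing_bump q m M L U p h c z l : (2 <= q)%N -> m = (q - 2 + p)%N ->
  smooth_chain m L U -> U m = two_kinks c z -> 0 <= h -> half_degree (2 * M) l ->
  exists2 xi, h <= xi <= p.+1%:R * h &
    pairing q (bump U p h 0%N) l =
    (h / 2) ^+ p * (4 * pi * (cosum l (c + xi) - cosum l (z + xi))).
Proof.
move=> q2 mE sU Um h0 hl.
have hq k := half_degree_dcosum (k := k) hl.
have [|xi /andP[x1 x2] e] := circint_iter_half_diff (psi := cosum (iter q (@dcosum R) l))
  (p := p) (k := 0) h sU (@cosum_continuous R _) (cosum_periodic (hq q))
  (@norm_cosum_le R _) _ h0; first by rewrite mE leq_addl.
exists xi; first by rewrite -natr1 mulrDl mul1r x1 /=; lra.
rewrite /pairing /bump e.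
pose u k t := U (k + p)%N (t - xi).
have sgn : (-1) ^+ q * (-1) ^+ (q - 2) = 1 :> R.
  by rewrite -exprD -signr_odd (_ : (q + (q - 2) = (q - 1) * 2)%N) ?oddM ?andbF//; lia.
have := @circint_parts_iter R (q - 2) u (fun k => cosum (iter k.+2 (@dcosum R) l)).
rewrite (_ : (q - 2).+2 = q); last by lia.
have cU k := smooth_chain_continuous (k := k) sU.
move=> -> //; first last.
- by move=> k; exact: cosum_primitive.
- move=> k km t; apply: is_derive_shift.
  have : (k + p < m)%N by lia.
  by move/(smooth_chain_primitive sU); rewrite -addSn; apply.
- by move=> k; exact: cosum_continuous.
- move=> k km; apply: continuous_translate; apply: cU; lia.
- by move=> k; exact: cosum_periodic (hq k.+2).
- move=> k km t; have [pU _ _ _] := sU.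
  by rewrite /u addrAC pU//; lia.
rewrite mulrCA (mulrA ((-1) ^+ q)) sgn mul1r /u -mE Um; congr (_ * _).
have cp x : continuous (fun t => parabola (t - x) * cosum (iter 2 (@dcosum R) l) t).
  apply: continuous_mul; last exact: cosum_continuous.
  exact: (continuous_translate (@parabola_continuous R)).
(* After q - 2 integrations by parts the top member of U meets the second derivative of the wave.
   Each parabola gives a point value and a multiple of the mean of the wave; the means cancel. *)
transitivity (circint (fun t => parabola (t - (c + xi)) * cosum (iter 2 (@dcosum R) l) t
  - parabola (t - (z + xi)) * cosum (iter 2 (@dcosum R) l) t)).
  congr circint; apply/funext => t; rewrite /two_kinks mulrBl.
  by rewrite !opprD !addrA !(addrAC t (- xi)).
rewrite circintB; [|exact: cp..].
rewrite !(circint_parabola _ hl); ring.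
Qed.

End Kinks.

(** * From chains to the function classes, and from failed approximation to the upper limit *)

Section ChainsAndClasses.
Variable R : realType.
Implicit Types (f g T : R -> R) (G : nat -> R -> R) (x L : R) (k m n q r s : nat) (y : nat -> R).

Lemma Delta_of_chain q y s m L G : smooth_chain m L G -> (q - 2 <= m)%N ->
  (forall i, (1 <= i <= 2 * s)%N ->
    convex_on_open (knot y s i) (knot y s i.-1) (fun x => (-1) ^+ i.-1 * G (q - 2)%N x)) ->
  Delta q y s (G 0%N).
Proof.
move=> sG qm pat; have [pG _ _ _] := sG; split; last split.
- exact: smooth_chain_continuous sG (leq0n m).
- exact: pG.
move=> i i2; set sg := (-1) ^+ i.-1.
pose g k x := sg * G k x.
have dg k : (k < m)%N -> primitive (g k) (g k.+1).
  by move=> km x; apply: is_derive_scale; exact: (smooth_chain_primitive sG km).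
have cg k : (k <= m)%N -> continuous (g k).
  by move=> km; apply: continuous_scale; exact: smooth_chain_continuous sG km.
have E := derive1n_chain dg.
split; last split; last split.
- exact/continuous_subspaceT/(cg 0%N).
- move=> k kq x _; rewrite (E k); last lia.
  have km : (k < m)%N by lia.
  by case: (dg k km x).
- by move=> k kq x _; rewrite (E k); [apply: cg; lia|lia].
- by rewrite (E (q - 2)%N qm); exact: pat.
Qed.

Lemma norm_derive1_le g L x : 0 <= L -> (forall x u, `|g (x + u) - g x| <= L * `|u|) ->
  `|derive1 g x| <= L.
Proof.
move=> L0 H; rewrite derive1E /derive.
set f := (X in lim (X @ _)).
(* Where the difference quotient diverges, derive1 is the junk value 0. *)
have [cf|df] := pselect (cvg (f @ 0^')); last by rewrite (dvgP df) normr0.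
rewrite -(lim_norm cf); apply: limr_le; first exact: is_cvg_norm cf.
near=> u; rewrite /f.
have u0 : u != 0 by near: u; exact: nbhs_dnbhs_neq.
rewrite /= /shift /= normrM normfV ler_pdivrMl ?normr_gt0//.
rewrite mulrC (_ : u *: 1 + x = x + u) //.
by rewrite addrC /GRing.scale /= mulr1.
Unshelve. all: by end_near.
Qed.

Lemma lipschitz_loc_abs_cont g L : 0 < L -> (forall x u, `|g (x + u) - g x| <= L * `|u|) ->
  loc_abs_cont g.
Proof.
move=> L0 H a b ab e e0; exists (e / L); first exact: divr_gt0.
move=> n u v uv _; rewrite ltr_pdivlMr// mulrC mulr_sumr; apply: le_lt_trans.
apply: ler_sum => i _; have [_ [uvi _]] := uv i (ltn_ord i).
have := H (u i) (v i - u i); rewrite (addrC (u i)) subrK => /le_trans; apply.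
by rewrite ger0_norm ?subr_ge0.
Qed.

(** The Lipschitz constant 2 of the derivative of order r - 1 yields both absolute continuity and
    the essential bound of the class. *)
Lemma W_of_chain r m G : smooth_chain m 2 G -> (r.-1 <= m)%N -> W r (G 0%N).
Proof.
move=> sG rm; have [pG _ lG _] := sG.
have E k : (k <= m)%N -> derive1n k (G 0%N) = G k.
  by apply: derive1n_chain => j jm; exact: smooth_chain_primitive sG jm.
split; first exact: pG.
split; last split.
- move=> k kr x; rewrite E; last by lia.
  have km : (k < m)%N by lia.
  by case: (smooth_chain_primitive sG km x).
- rewrite E//; apply: (@lipschitz_loc_abs_cont _ 2) => // x u; exact: lG.
- rewrite E//; apply/ess_supP; apply: nearW => x; rewrite lee_fin.
  by apply: norm_derive1_le => // z u; exact: lG.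
Qed.

Definition approximable q y s n f e :=
  exists T, [/\ trig_poly n T, Delta q y s T & forall x, `|f x - T x| <= e].

Lemma En_ge q y s n f e : ~ approximable q y s n f e -> (e%:E <= En q y s n f)%E.
Proof.
move=> na; apply: le_ereal_inf_tmp => _ /= [T [tT dT] <-].
rewrite leNgt; apply/negP => h; apply: na; exists T; split => // x.
rewrite -lee_fin; apply: le_trans (ltW h); apply: ereal_sup_ubound.
by exists x.
Qed.

Lemma limsup_En_infty q r s y f :
  (forall M n0, exists2 n, (n0 < n)%N & ~ approximable q y s n f (M / n%:R ^+ r)) ->
  limn_esup (fun n : nat => ((n%:R ^+ r)%:E * En q y s n f)%E) = +oo%E.
Proof.
move=> H; apply/eqyP => M M0; rewrite /limn_esup /limf_esup.
apply: le_ereal_inf_tmp => _ /= [V [n0 _ n0V] <-].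
have [n n0n na] := H M n0.
have n_gt0 : 0 < n%:R ^+ r :> R by rewrite exprn_gt0// ltr0n; lia.
have Mn := En_ge na.
apply: (@le_trans _ _ ((n%:R ^+ r)%:E * En q y s n f)%E); last first.
  by apply: ereal_sup_ubound; exists n => //; apply: n0V; exact: ltnW.
rewrite (_ : M = n%:R ^+ r * (M / n%:R ^+ r)); last by rewrite mulrC divfK// gt_eqF.
by rewrite EFinM; apply: lee_wpmul2l => //; rewrite lee_fin ltW.
Qed.

Lemma bump_convex q s y m L U p h i : (1 <= s)%N ->
  (forall i : nat, (1 <= i < 2 * s)%N -> y i.+1 < y i) ->
  y 1%N < y (2 * s)%N + 2 * pi -> m = (q - 2 + p)%N -> smooth_chain m L U ->
  U m = two_kinks (y 1%N) ((y 1%N + y 2%N) / 2) -> 0 <= h ->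
  p.+1%:R * h <= (y 1%N - y 2%N) / 2 -> p.+1%:R * h <= y (2 * s)%N + 2 * pi - y 1%N ->
  (1 <= i <= 2 * s)%N ->
  convex_on_open (knot y s i) (knot y s i.-1) (fun x => (-1) ^+ i.-1 * bump U p h (q - 2)%N x).
Proof.
move=> s1 yd yp mE sU Um h0 h1 h2 /andP[i1 i2].
set c := y 1%N; set z := (y 1%N + y 2%N) / 2.
have y21 : y 2%N < y 1%N by apply: yd; lia.
have yle j k := @knots_antitone R s y j k yd.
have ys2 : y (2 * s)%N <= y 2%N by apply: yle; lia.
have zc : z <= c by rewrite /z /c; lra.
have hp : h <= p.+1%:R * h by rewrite ler_peMl// ler1n.
set a := knot y s i; set b := knot y s i.-1; set sg := (-1) ^+ i.-1.
(* The hump at x sees the kinks on [x - (p + 1) h, x - h]. The two bounds on (p + 1) h keep this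
   enlarged interval to the right of z when i = 1, and to the right of c - 2 pi for every i. *)
suff conv : convex_on_open (a - p.+1%:R * h) (b - h) (fun x => sg * U m x).
  have := iter_half_diff_convex sU h0 (leq_trans (leq_addl (q - 2) p) (eq_leq (esym mE))) conv.
  move=> /(@convex_translate _ _ h).
  rewrite subrK -natr1 mulrDl mul1r (_ : a - _ + _ + h = a); last by ring.
  by rewrite (_ : (m - p = q - 2)%N)//; lia.
have aE : a = y i by rewrite /a /knot; case: (i) i1.
have ysi : y (2 * s)%N <= y i by apply: yle; lia.
rewrite Um -/c -/z {}aE.
have [i_1|i_1] := eqVneq i 1%N.
  have bE : b = y (2 * s)%N + 2 * pi by rewrite /b i_1 /knot eqxx.
  have -> : (fun x => sg * two_kinks c z x) = two_kinks c z.
    by apply/funext => x; rewrite /sg i_1 mul1r.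
  by rewrite bE i_1; apply: two_kinks_convex => //; rewrite /z /c; lra.
have bE : b = y i.-1 by rewrite /b /knot ifF//; apply/eqP; lia.
have [i_2|i_2] := eqVneq i 2%N.
  by rewrite /sg bE i_2; apply: two_kinks_concave => //; rewrite /z /c; lra.
have yi2 : y i.-1 <= y 2%N by apply: yle; lia.
by rewrite bE; apply: two_kinks_affine => //; rewrite /z /c; lra.
Qed.

End ChainsAndClasses.

(** * Choice of the scales N, n and h *)

Section ParameterChoice.
Variable R : realType.
Implicit Types (a w C M tau x h : R).

(** With tau = exp (-b), raise u <= exp u at u = b N / (j + 1) to the power j + 1; this bounds
    N^(j+1) tau^N. *)
Lemma poly_geometric tau (j : nat) : 0 < tau < 1 ->
  exists2 B, 0 <= B & forall N : nat, (0 < N)%N -> N%:R ^+ j * tau ^+ N <= B / N%:R.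
Proof.
move=> /andP[t0 t1]; pose b := - ln tau.
have b0 : 0 < b by rewrite oppr_gt0; apply: ln_lt0; rewrite t0 t1.
have j0 : 0 < j.+1%:R :> R by rewrite ltr0n.
exists ((j.+1%:R / b) ^+ j.+1); first by rewrite exprn_ge0// divr_ge0// ltW.
move=> N N0; have x0 : 0 < N%:R :> R by rewrite ltr0n.
rewrite ler_pdivlMr// mulrAC -exprSr.
have -> : tau ^+ N = (expR (- (b * N%:R / j.+1%:R))) ^+ j.+1.
  rewrite -expRM_natl mulrN mulrCA mulfV ?gt_eqF// mulr1 -mulNr opprK mulrC expRM_natl.
  by rewrite lnK.
rewrite -exprMn; apply: lerXn2r; rewrite ?nnegrE.
- by rewrite mulr_ge0// ?ltW// expR_ge0.
- by rewrite divr_ge0// ltW.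
have h : b * N%:R / j.+1%:R <= expR (b * N%:R / j.+1%:R).
  by apply: le_trans (expR_ge1Dx _); rewrite lerDr.
rewrite expRN ler_pdivrMr ?expR_gt0//.
apply: (@le_trans _ _ (j.+1%:R / b * (b * N%:R / j.+1%:R))).
  by rewrite le_eqVlt; apply/orP; left; apply/eqP; field; rewrite !gt_eqF.
by apply: ler_wpM2l => //; rewrite divr_ge0// ltW.
Qed.

Lemma exists_nat_ge (x : R) (n0 : nat) : exists2 N : nat, (n0 < N)%N & x <= N%:R.
Proof.
exists (maxn n0.+1 (Num.bound `|x|)); first by rewrite leq_max leqnn.
apply: (@le_trans _ _ (Num.bound `|x|)%:R); last by rewrite ler_nat leq_maxr.
exact/ltW/(le_lt_trans (ler_norm x))/archi_boundP.
Qed.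

(* With n = N^A and h = N^-(A + 2), the bump stays in a region where phi1 is of order N h << 1/n,
   while the weight h^p still dominates n^(1 - r) N^q. *)
Lemma gliding_parameters (q p s n0 : nat) a w C M tau sigma hmax : (3 <= q)%N ->
  0 < a -> 0 < w -> 0 <= C -> 0 <= M -> 0 < tau < 1 -> 0 < sigma < 1 -> 0 < hmax ->
  exists N n h, [/\ (n0 < n)%N, 0 < h <= hmax &
    let K := 2 * (n + s + N).+1%:R + 1 in
    K * (C * tau ^+ N + 2 * pi * (2 * (M / n%:R ^+ (q - 1 + p)) * (s + N)%:R ^+ q)) <
    w * ((h / 2) ^+ p * (4 * pi)) * (a - K * ((s + N)%:R * (p.+1%:R * h) + sigma ^+ N))].
Proof.
move=> q3 a0 w0 C0 M0 tauP sigmaP hmax0.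
(* The exponent needed for the bound [X] is (A + 2) p + A + q + 1 <= A r, that is q + 2p + 1 <= A (q
   - 2); with q >= 3 this value of A suffices. *)
pose A := (q + 2 * p + 1)%N; pose r := (q - 1 + p)%N.
have [B1 B10 HB1] := poly_geometric (A + (A + 2) * p) tauP.
have [B2 B20 HB2] := poly_geometric A sigmaP.
have pi0 := pi_gt0 R.
pose c1 := 14 * p.+1%:R + 7 * B2.
pose c2 := 7 * C * B1 + 28 * pi * M * 2 ^+ q.
(* The right side of the goal, multiplied by D = h^-p, when its last bracket is as small as a/2.
   [T1] ensures at least a/2, and [T2] puts the left side times D below [eps]. *)
pose eps := 2 * pi * w * a / 2 ^+ p.
have eps0 : 0 < eps by rewrite divr_gt0 ?exprn_gt0// !mulr_gt0.
have p0 : 0 <= p.+1%:R :> R by [].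
have c10 : 0 <= c1 by rewrite /c1; lra.
have c20 : 0 <= c2 by rewrite addr_ge0// !mulr_ge0 ?exprn_ge0// ltW.
have i1 : 0 <= hmax^-1 by rewrite invr_ge0 ltW.
have i2 : 0 <= c1 / (a / 2) by rewrite !divr_ge0// ltW.
have i3 : 0 <= c2 / eps by rewrite divr_ge0// ltW.
have [N N0 Nbig] := exists_nat_ge (hmax^-1 + (c1 / (a / 2) + (c2 / eps + 1))) (n0 + s + 1).
pose x : R := N%:R.
have Npos : (0 < N)%N by exact: leq_ltn_trans N0.
have x1 : 1 <= x by rewrite /x ler1n.
have x0 : 0 < x by lra.
have xn0 : x != 0 by rewrite gt_eqF.
have NA : (N <= N ^ A)%N.
  by rewrite -[X in (X <= _)%N]expn1; apply: leq_pexp2l => //; rewrite /A addn1.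
exists N, (N ^ A)%N, (x ^- (A + 2)); split.
- by apply: leq_trans NA; move: N0; clear; lia.
- rewrite invr_gt0 exprn_gt0//= -[hmax]invrK lef_pV2 ?posrE ?invr_gt0 ?exprn_gt0//.
  apply: (@le_trans _ _ x); first by rewrite /x; lra.
  by rewrite -[X in X <= _]expr1; apply: ler_weXn2l => //; rewrite addnS.
move=> K.
have K7 : K <= 7 * x ^+ A.
  have : (2 * (N ^ A + s + N).+1 + 1 <= 7 * N ^ A)%N.
    by move: N0 NA; set u := (N ^ A)%N; clearbody u; clear; lia.
  by rewrite -(ler_nat R) natrD !natrM natrX.
have K0 : 0 <= K by rewrite /K addr_ge0// mulr_ge0.
have sN : (s + N)%:R <= 2 * x.
  by rewrite /x -natrM ler_nat; move: N0; clear; lia.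
set h := x ^- (A + 2).
have h0 : 0 <= h by rewrite invr_ge0 exprn_ge0// ltW.
pose D := x ^+ ((A + 2) * p).
have D0 : 0 < D by rewrite exprn_gt0.
have hp : (h / 2) ^+ p = (D * 2 ^+ p)^-1.
  by rewrite -invfM exprVn exprMn -exprM mulrC.
have xA : 0 < x ^+ A by rewrite exprn_gt0.
have sg0 : 0 <= sigma ^+ N by rewrite exprn_ge0// ltW//; case/andP: sigmaP.
have tau0 : 0 <= tau ^+ N by rewrite exprn_ge0// ltW//; case/andP: tauP.
have T1 : K * ((s + N)%:R * (p.+1%:R * h) + sigma ^+ N) <= a / 2.
  apply: (@le_trans _ _ (7 * x ^+ A * (2 * x * (p.+1%:R * h) + sigma ^+ N))).
    apply: ler_pM => //; first by rewrite addr_ge0// !mulr_ge0.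
    by rewrite lerD2r ler_wpM2r// mulr_ge0.
  have -> : 7 * x ^+ A * (2 * x * (p.+1%:R * h) + sigma ^+ N) =
      14 * p.+1%:R / x + 7 * (x ^+ A * sigma ^+ N).
    by rewrite /h exprD; field; rewrite xn0 expf_neq0.
  apply: (@le_trans _ _ (c1 / x)).
    rewrite /c1 (_ : (14 * p.+1%:R + 7 * B2) / x = 14 * p.+1%:R / x + 7 * (B2 / x)).
      by rewrite lerD2l; apply: ler_wpM2l => //; exact: HB2.
    by field.
  rewrite ler_pdivrMr// mulrC -ler_pdivrMr; last by lra.
  by rewrite /x; lra.
have nr : (N ^ A)%:R ^+ r = x ^+ (A * r) by rewrite natrX -exprM.
have T2 : D * (K * (C * tau ^+ N +
    2 * pi * (2 * (M / (N ^ A)%:R ^+ r) * (s + N)%:R ^+ q))) < eps.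
  rewrite nr; have xAr : 0 < x ^+ (A * r) by rewrite exprn_gt0.
  apply: (@le_lt_trans _ _ (D * (7 * x ^+ A * (C * tau ^+ N +
      2 * pi * (2 * (M / x ^+ (A * r)) * (2 * x) ^+ q))))).
    rewrite ler_pM2l//; apply: ler_pM => //.
      apply: addr_ge0; first exact: mulr_ge0.
      apply: mulr_ge0; first lra.
      apply: mulr_ge0; last exact: exprn_ge0.
      by apply: mulr_ge0 => //; rewrite divr_ge0// ltW.
    rewrite lerD2l; apply: ler_wpM2l; first lra.
    apply: ler_wpM2l; first by rewrite mulr_ge0// divr_ge0// ltW.
    by apply: lerXn2r; rewrite ?nnegrE// mulr_ge0// ltW.
  have -> : D * (7 * x ^+ A * (C * tau ^+ N + 2 * pi * (2 * (M / x ^+ (A * r)) * (2 * x) ^+ q))) =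
      7 * C * (x ^+ (A + (A + 2) * p) * tau ^+ N) +
      28 * pi * M * 2 ^+ q * (x ^+ ((A + 2) * p + A + q) / x ^+ (A * r)).
    by rewrite /D exprMn !exprD; field; rewrite expf_neq0.
  have X : x ^+ ((A + 2) * p + A + q) / x ^+ (A * r) <= 1 / x.
    rewrite ler_pdivlMr// mulrAC -exprSr ler_pdivrMr// mul1r.
    apply: ler_weXn2l => //; rewrite /r /A; move: q3; clear; nia.
  apply: (@le_lt_trans _ _ (c2 / x)).
    rewrite /c2 (_ : (7 * C * B1 + 28 * pi * M * 2 ^+ q) / x =
      7 * C * (B1 / x) + 28 * pi * M * 2 ^+ q * (1 / x)); last by field.
    apply: lerD; apply: ler_wpM2l => //; first exact: mulr_ge0.
      exact: HB1.
    by rewrite !mulr_ge0 ?exprn_ge0// ltW.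
  rewrite ltr_pdivrMr// mulrC -ltr_pdivrMr//.
  by rewrite /x; lra.
rewrite -(ltr_pM2l D0); apply: (lt_le_trans T2).
rewrite hp (_ : D * (w * ((D * 2 ^+ p)^-1 * (4 * pi)) * _) =
  4 * pi * w / 2 ^+ p * (a - K * ((s + N)%:R * (p.+1%:R * h) + sigma ^+ N))).
  rewrite /eps (_ : 2 * pi * w * a / 2 ^+ p = 4 * pi * w / 2 ^+ p * (a / 2)); last first.
    by field; rewrite expf_neq0.
  by apply: ler_wpM2l; [rewrite divr_ge0 ?exprn_ge0// !mulr_ge0// ltW|lra].
by field; rewrite expf_neq0//= gt_eqF.
Qed.

End ParameterChoice.

(** * Limits with geometric error control *)

Section GeometricLimit.
Variable R : realType.
Implicit Types (u w : nat -> R) (B e a b : R) (g : R -> R).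

(** The intervals of radius 2 w_j B around u_j are nested because the weights halve; the supremum of
    the left ends lies in all of them. *)
Lemma geometric_limit u w B : 0 <= B -> (forall j, 0 <= w j) -> (forall j, w j.+1 <= w j / 2) ->
  (forall j, `|u j.+1 - u j| <= w j * B) -> exists l, forall j, `|l - u j| <= 2 * w j * B.
Proof.
move=> B0 w0 wS uS; pose lo j := u j - 2 * w j * B; pose up j := u j + 2 * w j * B.
have wB j : w j.+1 * B <= w j * B / 2 by have := ler_wpM2r B0 (wS j); lra.
have lo_mono i k : lo i <= lo (i + k)%N.
  elim: k => [|k IH]; first by rewrite addn0.
  rewrite addnS (le_trans IH)// /lo; have := uS (i + k)%N; have := wB (i + k)%N.
  by rewrite ler_norml => ? /andP[? ?]; lra.
have up_mono i k : up (i + k)%N <= up i.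
  elim: k => [|k IH]; first by rewrite addn0.
  rewrite addnS (le_trans _ IH)// /up; have := uS (i + k)%N; have := wB (i + k)%N.
  by rewrite ler_norml => ? /andP[? ?]; lra.
have lo_up i j : lo i <= up j.
  apply: (le_trans (lo_mono i j)); apply: (le_trans _ (up_mono j i)); rewrite addnC /lo /up.
  by have := mulr_ge0 (w0 (j + i)%N) B0; lra.
exists (sup (range lo)) => j; rewrite ler_distl; apply/andP; split.
  by apply: ub_le_sup; [exists (up 0%N) => _ [i _ <-]; exact: lo_up|exists j].
by apply: ge_sup; [exists (lo 0%N), 0%N|move=> _ [i _ <-]; exact: lo_up].
Qed.

Lemma halving_small w B e : 0 <= B -> (forall j, 0 <= w j) -> (forall j, w j.+1 <= w j / 2) ->
  0 < e -> exists j, 2 * w j * B < e.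
Proof.
move=> B0 w0 wS e0.
have wj j : w j * 2 ^+ j <= w 0%N.
  elim: j => [|j IH]; first by rewrite mulr1.
  apply: le_trans IH; rewrite exprS mulrA ler_wpM2r ?exprn_ge0//.
  by have := wS j; lra.
have [j _ jb] := exists_nat_ge (2 * w 0%N * B / e + 1) 0.
exists j; have jl : j%:R <= 2 ^+ j :> R by rewrite -natrX ler_nat ltnW// ltn_expl.
have j2 : 0 < 2 ^+ j :> R by rewrite exprn_gt0.
have h : 2 * w 0%N * B < e * 2 ^+ j.
  have : 2 * w 0%N * B / e < 2 ^+ j by lra.
  by rewrite ltr_pdivrMr//; lra.
rewrite -(ltr_pM2r j2); apply: le_lt_trans h.
by have := ler_wpM2r B0 (wj j); lra.
Qed.

Lemma convex_limit a b g (H : nat -> R -> R) (d : nat -> R) :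
  (forall j, convex_on_open a b (H j)) -> (forall j x, `|g x - H j x| <= d j) ->
  (forall e, 0 < e -> exists j, d j < e) -> convex_on_open a b g.
Proof.
move=> cH gH d0 x z t xab zab t01; apply: le_of_small => e e0.
have [j dj] := d0 (e / 2) ltac:(lra).
have := cH j x z t xab zab t01; case/andP: t01 => t0 t1.
have := gH j (t * x + (1 - t) * z); rewrite ler_norml => /andP[h1 h2].
have hx : t * (H j x - d j) <= t * g x.
  by apply: ler_wpM2l => //; have := gH j x; rewrite ler_norml => /andP[? ?]; lra.
have hz : (1 - t) * (H j z - d j) <= (1 - t) * g z.
  by apply: ler_wpM2l; [lra|have := gH j z; rewrite ler_norml => /andP[? ?]; lra].
lra.
Qed.

End GeometricLimit.

(** * Size of the test waves near y_1 and away from it *)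

Section TestWaveBounds.
Variables (R : realType) (s : nat) (y : nat -> R).
Hypothesis s1 : (1 <= s)%N.
Hypothesis y_decr : forall i : nat, (1 <= i < 2 * s)%N -> y i.+1 < y i.
Hypothesis y_period : y 1%N < y (2 * s)%N + 2 * pi.
Implicit Types (t al x : R) (N : nat).

Lemma norm_tail_wave N t : `|tail_wave s y N t| <= (cos ((t - y 1%N) / 2) ^+ 2) ^+ N.
Proof.
rewrite tail_waveE normrM -exprM normrX.
rewrite [X in _ * X](_ : _ = cos ((t - y 1%N) / 2) ^+ (2 * N)); last first.
  by rewrite !exprM real_normK ?num_real.
apply: ler_piMl; first by rewrite exprM exprn_ge0// sqr_ge0.
rewrite normr_prod; apply: prodr_ile1 => i _.
by rewrite normr_ge0 sin_max.
Qed.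

Lemma norm_test_wave N al t :
  `|cosum (test_wave s y N al) t| <= (cos ((t - y 1%N) / 2) ^+ 2) ^+ N.
Proof.
rewrite test_waveE normrM; apply: le_trans (norm_tail_wave N t).
by rewrite ler_piMl// cos_max.
Qed.

Lemma test_wave_lipschitz N al x t : 0 <= t ->
  `|cosum (test_wave s y N al) (x + t) - cosum (test_wave s y N al) x| <= (s + N)%:R * t.
Proof.
move=> t0; have [|c _ ->] := primitive_MVT (a := x) (b := x + t) _ (@cosum_primitive R (test_wave s y N al)).
  by rewrite lerDl.
rewrite (_ : x + t - x = t); last by ring.
rewrite normrM (ger0_norm t0); apply: ler_wpM2r => //.
apply: (le_trans (norm_cosum_le _ _)).
apply: (le_trans (amplitude_dcosum (half_degree_test s1 (N := N) (al := al)))).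
by rewrite amplitude_test mulr1 natrM mulrAC mulfV ?mul1r.
Qed.

(** The value of [phi0] at y_1. It does not depend on N, because the factor cos ((t - y_1)/2) equals
    1 there. *)
Definition phi0_peak : R := \prod_(2 <= i < (2 * s).+1) sin ((y 1%N - y i) / 2).

Lemma phi0_peak_gt0 : 0 < phi0_peak.
Proof.
rewrite /phi0_peak big_nat; apply: prodr_gt0 => i /andP[i2 is2].
have yle j k := @knots_antitone R s y j k y_decr.
have h1 : y (2 * s)%N <= y i by apply: yle; lia.
have h2 : y i <= y 2%N by apply: yle; lia.
have h3 : y 2%N < y 1%N by apply: y_decr; lia.
by have yp := y_period; apply: sin_gt0_pi; lra.
Qed.

Lemma phi0_at_peak N : cosum (phi0 s y N) (y 1%N) = phi0_peak.
Proof. by rewrite phi0E tail_waveE subrr mul0r cos0 expr1n mulr1 mul1r. Qed.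

Lemma phi1_at_peak N : cosum (phi1 s y N) (y 1%N) = 0.
Proof. by rewrite phi1E subrr mul0r sin0 mul0r. Qed.

Lemma cos_sqr_le x t : 0 <= x -> x <= `|t| -> `|t| <= pi / 2 -> cos t ^+ 2 <= cos x ^+ 2.
Proof.
move=> x0 xt tp; rewrite -(cos_norm t).
have P := pi_gt0 R.
have c0 : 0 <= cos `|t| by apply: cos_ge0_pihalf; have := normr_ge0 t; lra.
have cx : cos `|t| <= cos x.
  by rewrite leNgt ltr_cos ?in_itv /= -?leNgt//; apply/andP; split => //; lra.
by rewrite lerXn2r// nnegrE// (le_trans c0).
Qed.

Lemma cos_sqr_lt1 x : 0 < x < pi / 2 -> 0 < cos x ^+ 2 < 1.
Proof.
move=> /andP[x0 xp]; have P := pi_gt0 R.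
have c0 : 0 < cos x by apply: cos_gt0_pihalf; lra.
have c1 : cos x < 1.
  by rewrite -(cos0 R) ltr_cos ?in_itv /= ?lexx//; apply/andP; split; lra.
by rewrite exprn_gt0//= expr_lt1// ltW.
Qed.

End TestWaveBounds.

Lemma quarter_gap (R : realType) s (y : nat -> R) : (1 <= s)%N ->
  (forall i : nat, (1 <= i < 2 * s)%N -> y i.+1 < y i) -> y 1%N < y (2 * s)%N + 2 * pi ->
  0 < (y 1%N - y 2%N) / 4 < pi / 2.
Proof.
move=> s1 yd yp; have yle j k := @knots_antitone R s y j k yd.
have h1 : y (2 * s)%N <= y 2%N by apply: yle; lia.
have h2 : y 2%N < y 1%N by apply: yd; lia.
by apply/andP; split; lra.
Qed.

(** * Pairings of one hump, and failure of approximation after adding it *)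

Section BumpPairings.
Variables (R : realType) (q s p : nat) (y : nat -> R).
Hypothesis q3 : (3 <= q)%N.
Hypothesis s1 : (1 <= s)%N.
Hypothesis y_decr : forall i : nat, (1 <= i < 2 * s)%N -> y i.+1 < y i.
Hypothesis y_period : y 1%N < y (2 * s)%N + 2 * pi.
Variables (U : nat -> R -> R) (L : R).
Let c := y 1%N.
Let z := (y 1%N + y 2%N) / 2.
Let d := (y 1%N - y 2%N) / 4.
Let m := (q - 2 + p)%N.
Hypothesis U_chain : smooth_chain m L U.
Hypothesis U_top : U m = two_kinks c z.
Implicit Types (N : nat) (h t al : R).

Let gap : 0 < d < pi / 2 := quarter_gap s1 y_decr y_period.

(** Since y_1 - z = 2d, a negative mass displaced to the right by at most d stays between d and 2d
    to the left of y_1, so half its distance to y_1 is at least d/2. *)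
Definition far_decay : R := cos (d / 2) ^+ 2.

Lemma far_decay_bounds : 0 < far_decay < 1.
Proof. by apply: cos_sqr_lt1; have := gap; lra. Qed.

Lemma test_wave_far N al t : 0 <= t <= d ->
  `|cosum (test_wave s y N al) (z + t)| <= far_decay ^+ N.
Proof.
move=> /andP[t0 td]; have /andP[d0 dp] := gap.
apply: (le_trans (norm_test_wave _ _ _ _ _)).
have e : (z + t - c) / 2 = - (d - t / 2) by rewrite /z /c /d; field.
rewrite -/c e; apply: lerXn2r; rewrite ?nnegrE ?sqr_ge0//.
by apply: cos_sqr_le; rewrite ?normrN ?ger0_norm; lra.
Qed.

Lemma test_wave_near N al h t : 0 < h -> h <= t <= d ->
  `|cosum (test_wave s y N al) (c + t)| <= (cos (h / 2) ^+ 2) ^+ N.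
Proof.
move=> h0 /andP[t0 td]; have /andP[d0 dp] := gap.
apply: (le_trans (norm_test_wave _ _ _ _ _)).
rewrite -/c (_ : (c + t - c) / 2 = t / 2); last by field.
apply: lerXn2r; rewrite ?nnegrE ?sqr_ge0//.
by apply: cos_sqr_le; rewrite ?ger0_norm; lra.
Qed.

Definition bump_mass h : R := (h / 2) ^+ p * (4 * pi).

Lemma bump_mass_ge0 h : 0 <= h -> 0 <= bump_mass h.
Proof. by move=> h0; rewrite mulr_ge0 ?exprn_ge0 ?divr_ge0// mulr_ge0// pi_ge0. Qed.

Lemma pairing_bump_wave h N al : 0 <= h -> exists2 xi, h <= xi <= p.+1%:R * h &
  pairing q (bump U p h 0%N) (test_wave s y N al) =
  bump_mass h * (cosum (test_wave s y N al) (c + xi) - cosum (test_wave s y N al) (z + xi)).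
Proof.
move=> h0; have q2 : (2 <= q)%N by apply: leq_trans q3.
have hl := half_degree_test (y := y) s1 (N := N) (al := al).
have [xi xiP e] := pairing_bump (p := p) (h := h) q2 (erefl m) U_chain U_top h0 hl.
by exists xi => //; rewrite e /bump_mass mulrA.
Qed.

Lemma pairing_bump_phi0 h N : 0 <= h -> p.+1%:R * h <= d ->
  bump_mass h * (phi0_peak s y - ((s + N)%:R * (p.+1%:R * h) + far_decay ^+ N)) <=
  pairing q (bump U p h 0%N) (phi0 s y N).
Proof.
move=> h0 hd; have [xi /andP[x1 x2] ->] := pairing_bump_wave N (- (y 1%N / 2)) h0.
apply: ler_wpM2l; first exact: bump_mass_ge0.
have xi0 : 0 <= xi by exact: le_trans x1.
have := test_wave_far N (- (y 1%N / 2)) (t := xi) ltac:(lra).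
have := test_wave_lipschitz y s1 N (- (y 1%N / 2)) c xi0.
rewrite -/(phi0 s y N) (phi0_at_peak s y N).
have : (s + N)%:R * xi <= (s + N)%:R * (p.+1%:R * h) by apply: ler_wpM2l.
rewrite !ler_norml => ? /andP[? ?] /andP[? ?]; lra.
Qed.

Lemma pairing_bump_phi1 h N : 0 <= h -> p.+1%:R * h <= d ->
  pairing q (bump U p h 0%N) (phi1 s y N) <=
  bump_mass h * ((s + N)%:R * (p.+1%:R * h) + far_decay ^+ N).
Proof.
move=> h0 hd; have [xi /andP[x1 x2] ->] := pairing_bump_wave N (- (y 1%N / 2) - pi / 2) h0.
apply: ler_wpM2l; first exact: bump_mass_ge0.
have xi0 : 0 <= xi by exact: le_trans x1.
have := test_wave_far N (- (y 1%N / 2) - pi / 2) (t := xi) ltac:(lra).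
have := test_wave_lipschitz y s1 N (- (y 1%N / 2) - pi / 2) c xi0.
rewrite -/(phi1 s y N) (phi1_at_peak s y N).
have : (s + N)%:R * xi <= (s + N)%:R * (p.+1%:R * h) by apply: ler_wpM2l.
rewrite !ler_norml => ? /andP[? ?] /andP[? ?]; lra.
Qed.

(** What the induction needs to know of the humps already placed: for large N both test waves barely
    see them. *)
Definition decaying (g : R -> R) C tau := forall N,
  `|pairing q g (phi0 s y N)| <= C * tau ^+ N /\ `|pairing q g (phi1 s y N)| <= C * tau ^+ N.

Lemma decaying_bump h : 0 < h -> p.+1%:R * h <= d ->
  decaying (bump U p h 0%N) (2 * bump_mass h) (cos (h / 2) ^+ 2).
Proof.
move=> h0 hd N; have /andP[d0 dp] := gap.
have hp : h <= p.+1%:R * h by rewrite ler_peMl ?ler1n// ltW.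
have M0 := bump_mass_ge0 (ltW h0).
have near_far : far_decay ^+ N <= (cos (h / 2) ^+ 2) ^+ N.
  apply: lerXn2r; rewrite ?nnegrE ?sqr_ge0//.
  by apply: cos_sqr_le; rewrite ?ger0_norm; lra.
have B al : `|pairing q (bump U p h 0%N) (test_wave s y N al)| <=
    2 * bump_mass h * (cos (h / 2) ^+ 2) ^+ N.
  have [xi /andP[x1 x2] ->] := pairing_bump_wave N al (ltW h0).
  rewrite normrM (ger0_norm M0) -mulrA [leRHS]mulrCA; apply: ler_wpM2l => //.
  apply: (le_trans (ler_normB _ _)).
  have := test_wave_far N al (t := xi) ltac:(lra).
  have := test_wave_near N al h0 (t := xi) ltac:(lra); lra.
by split; exact: B.
Qed.

Lemma decaying_add f g C1 C2 tau1 tau2 w : continuous f -> continuous g ->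
  0 <= C1 -> 0 <= C2 -> 0 < tau1 < 1 -> 0 < tau2 < 1 -> 0 <= w ->
  decaying f C1 tau1 -> decaying g C2 tau2 ->
  decaying (fun t => f t + w * g t) (C1 + w * C2) (Num.max tau1 tau2).
Proof.
move=> cf cg C10 C20 /andP[t10 _] /andP[t20 _] w0 df dg N.
have le1 : tau1 ^+ N <= Num.max tau1 tau2 ^+ N.
  by apply: lerXn2r; rewrite ?nnegrE ?le_max ?lexx ?orbT// ltW.
have le2 : tau2 ^+ N <= Num.max tau1 tau2 ^+ N.
  by apply: lerXn2r; rewrite ?nnegrE ?le_max ?lexx ?orbT ?(ltW t10)// ltW.
have B l : `|pairing q f l| <= C1 * tau1 ^+ N -> `|pairing q g l| <= C2 * tau2 ^+ N ->
    `|pairing q (fun t => f t + w * g t) l| <= (C1 + w * C2) * Num.max tau1 tau2 ^+ N.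
  move=> h1 h2; rewrite pairing_add ?pairing_scale//; last exact: continuous_scale.
  apply: (le_trans (ler_normD _ _)); rewrite [`|w * _|]normrM (ger0_norm w0) mulrDl; apply: lerD.
    by apply: (le_trans h1); apply: ler_wpM2l.
  by rewrite -mulrA; apply: ler_wpM2l => //; apply: (le_trans h2); apply: ler_wpM2l.
by have [f0 f1] := df N; have [g0 g1] := dg N; split; exact: B.
Qed.

(** Estimating both sides of [pairing_phi0_le] for g plus the hump contradicts the choice of scales.
    The factor 2 before M / n^r leaves half of the excluded error to the humps added later. *)
Lemma bump_not_approximable g w C tau M n0 :
  continuous g -> periodic2pi g -> 0 < w -> 0 <= C -> 0 < tau < 1 -> 0 <= M ->
  decaying g C tau -> exists n h, [/\ (n0 < n)%N, 0 < h, p.+1%:R * h <= d,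
    p.+1%:R * h <= y (2 * s)%N + 2 * pi - y 1%N &
    ~ approximable q y s n (fun x => g x + w * bump U p h 0%N x)
        (2 * (M / n%:R ^+ (q - 1 + p)))].
Proof.
move=> cg pg w0 C0 tauP M0 dg; have /andP[d0 dp] := gap.
pose e := y (2 * s)%N + 2 * pi - y 1%N.
have e0 : 0 < e by rewrite subr_gt0.
have p0 : 0 < p.+1%:R :> R by rewrite ltr0n.
have a0 := phi0_peak_gt0 s1 y_decr y_period.
have hmax0 : 0 < Num.min d e / p.+1%:R by rewrite divr_gt0// lt_min d0.
have [N [n [h [n0n /andP[h0]]]]] :=
  gliding_parameters p s n0 q3 a0 w0 C0 M0 tauP far_decay_bounds hmax0.
rewrite ler_pdivlMr// mulrC le_min => /andP[hd he] ineq.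
exists n, h; split => // -[T [tT dT GT]].
have sB := bump_chain p h U_chain.
have [pB _ _ _] := sB.
have cB : continuous (bump U p h 0%N) by exact: smooth_chain_continuous sB (leq0n _).
have cG : continuous (fun x => g x + w * bump U p h 0%N x).
  by apply: continuous_add => //; exact: continuous_scale.
have pG : periodic2pi (fun x => g x + w * bump U p h 0%N x).
  by move=> x; rewrite pg pB.
have := pairing_phi0_le q3 s1 y_decr y_period N cG pG tT dT GT.
rewrite !pairing_add ?pairing_scale//; try exact: continuous_scale.
have b0 := pairing_bump_phi0 N (ltW h0) hd.
have b1 := pairing_bump_phi1 N (ltW h0) hd.
have [] := dg N; rewrite !ler_norml => /andP[g0 _] /andP[_ g1].
move: ineq; rewrite /= -/(bump_mass h).
set K2 := 2 * (n + s + N).+1%:R.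
set E := 2 * pi * (_ * (s + N)%:R ^+ q).
set Y := _ + far_decay ^+ N in b0 b1 *.
have K20 : 0 <= K2 by rewrite mulr_ge0.
have := ler_wpM2l (ltW w0) b0; have := ler_wpM2l K20 (ler_wpM2l (ltW w0) b1).
have := ler_wpM2l K20 g1; move: g0.
set P0 := pairing q g (phi0 s y N); set P1 := pairing q g (phi1 s y N).
set Q0 := pairing q _ (phi0 s y N); set Q1 := pairing q _ (phi1 s y N).
set H := bump_mass h; set a := phi0_peak s y; set ct := C * _.
clearbody K2 E Y P0 P1 Q0 Q1 H a ct; lra.
Qed.

End BumpPairings.

(** * The gliding-hump sum for r >= q - 1 *)

Section GlidingHump.
Variables (R : realType) (q s p : nat) (y : nat -> R).
Hypothesis q3 : (3 <= q)%N.
Hypothesis s1 : (1 <= s)%N.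
Hypothesis y_decr : forall i : nat, (1 <= i < 2 * s)%N -> y i.+1 < y i.
Hypothesis y_period : y 1%N < y (2 * s)%N + 2 * pi.
Variables (U : nat -> R -> R) (L : R).
Let c := y 1%N.
Let z := (y 1%N + y 2%N) / 2.
Let m := (q - 2 + p)%N.
Let r := (q - 1 + p)%N.
Hypothesis L0 : 0 < L.
Hypothesis U_chain : smooth_chain m L U.
Hypothesis U_top : U m = two_kinks c z.
Implicit Types (G : nat -> R -> R) (w : R).

Definition pattern G := forall i, (1 <= i <= 2 * s)%N ->
  convex_on_open (knot y s i) (knot y s i.-1) (fun x => (-1) ^+ i.-1 * G (q - 2)%N x).

(* A partial sum together with the weight of the next hump. *)
Definition partial_sum (st : (nat -> R -> R) * R) :=
  [/\ 0 < st.2 /\ st.2 * L <= 1, smooth_chain m (2 - 2 * st.2 * L) st.1, pattern st.1 &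
      exists C tau, [/\ 0 <= C, 0 < tau < 1 & decaying q s y (st.1 0%N) C tau]].

(* The next weight is so small that the remaining humps preserve the lower bound at stage j. *)
Definition hump_step (j : nat) (st st' : (nat -> R -> R) * R) :=
  [/\ exists h, st'.1 = (fun k x => st.1 k x + st.2 * bump U p h k x), st'.2 <= st.2 / 2 &
    exists2 n, (j < n)%N & forall F : R -> R,
      (forall x, `|F x - st'.1 0%N x| <= 2 * st'.2 * L) ->
      ~ approximable q y s n F (j.+1%:R / n%:R ^+ r)].

Lemma pattern_add G1 G2 w : 0 <= w -> pattern G1 -> pattern G2 ->
  pattern (fun k x => G1 k x + w * G2 k x).
Proof.
move=> w0 P1 P2 i iP x x' t xab x'ab t01.
have h1 := P1 i iP x x' t xab x'ab t01.
have h2 := ler_wpM2l w0 (P2 i iP x x' t xab x'ab t01).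
set sg := (-1) ^+ i.-1 in h1 h2 *; lra.
Qed.

Lemma hump_step_exists j st : partial_sum st ->
  exists st', partial_sum st' /\ hump_step j st st'.
Proof.
case: st => G w [/= [w0 wL] sG PG [C [tau [C0 tauP dG]]]].
have [pG _ _ _] := sG.
have cG0 : continuous (G 0%N) by exact: smooth_chain_continuous sG (leq0n _).
have [|n [h [jn h0 hd he na]]] := bump_not_approximable q3 s1 y_decr y_period U_chain U_top j
  cG0 (pG 0%N (leq0n _)) w0 C0 tauP (M := j.+1%:R) _ dG; first by [].
have sB := bump_chain p h U_chain.
have cB0 : continuous (bump U p h 0%N) by exact: smooth_chain_continuous sB (leq0n _).
have nr : 0 < n%:R ^+ r :> R by rewrite exprn_gt0// ltr0n; apply: leq_trans jn.
pose e : R := j.+1%:R / n%:R ^+ r.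
have e0 : 0 < e by rewrite divr_gt0.
(* The first term makes the weights halve, so all later humps together stay within 2 w' L; the
   second makes this at most e, half of the excluded error 2e. *)
pose w' := Num.min (w / 2) (e / (2 * L)).
have w'0 : 0 < w' by rewrite lt_min !divr_gt0// mulr_gt0.
have w'w : w' <= w / 2 by rewrite ge_min lexx.
have w'e : 2 * w' * L <= e.
  have : w' <= e / (2 * L) by rewrite ge_min lexx orbT.
  by rewrite ler_pdivlMr ?mulr_gt0//; lra.
have w'L : w' * L <= w * L / 2 by have := ler_wpM2r (ltW L0) w'w; lra.
exists ((fun k x => G k x + w * bump U p h k x), w'); split; split => /=.
- by split => //; lra.
(* The hump costs w L, and w' L <= w L / 2 gives 2 - 2 w L + w L <= 2 - 2 w' L. *)
- have := smooth_chain_add sG (smooth_chain_scale w sB).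
  by apply: smooth_chain_le; rewrite gtr0_norm//; lra.
- apply: pattern_add => //; first exact: ltW.
  move=> i iP; apply: (bump_convex s1 y_decr y_period (erefl m) U_chain) => //; first exact: ltW.
  apply: (le_trans hd); have /andP[] := quarter_gap s1 y_decr y_period; lra.
- have dB := decaying_bump q3 s1 y_decr y_period U_chain U_top h0 hd.
  have M0 := bump_mass_ge0 p (ltW h0).
  have hp : h <= p.+1%:R * h by rewrite ler_peMl ?ler1n// ltW.
  have := quarter_gap s1 y_decr y_period => /andP[d0 dp].
  have tau2 : 0 < cos (h / 2) ^+ 2 < 1 by apply: cos_sqr_lt1; lra.
  exists (C + w * (2 * bump_mass p h)), (Num.max tau (cos (h / 2) ^+ 2)); split.
  + by apply: addr_ge0 => //; apply: mulr_ge0; [exact: ltW|exact: mulr_ge0].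
  + have /andP[t1 t2] := tauP; have /andP[t3 t4] := tau2.
    by rewrite lt_max t1 gt_max t2 t4.
  + by apply: decaying_add => //; [rewrite mulr_ge0|exact: ltW].
- by exists h.
- exact: w'w.
exists n => // F FG [T [tT dT FT]]; apply: na; exists T; split => // x.
rewrite -/r -/e (_ : _ - T x = (F x - T x) - (F x - (G 0%N x + w * bump U p h 0%N x))); last by ring.
apply: (le_trans (ler_normB _ _)); rewrite mulr_natl mulr2n; apply: lerD; first exact: FT.
by apply: (le_trans (FG x)).
Qed.

Lemma gliding_hump : exists f : R -> R, [/\ Delta q y s f, W r f &
  forall M n0, exists2 n, (n0 < n)%N & ~ approximable q y s n f (M / n%:R ^+ r)].
Proof.
have /choice[next nextP] : forall a : nat * ((nat -> R -> R) * R),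
    exists b, partial_sum a.2 -> partial_sum b /\ hump_step a.1 a.2 b.
  move=> [j st]; have [/hump_step_exists|nst] := pselect (partial_sum st).
    by move=> /(_ j)[st' h]; exists st'.
  by exists st.
(* The initial weight makes the allowance 2 - 2 w L equal to 0, which the zero chain meets. *)
pose st := fix st (j : nat) := if j is j'.+1 then next (j', st j') else ((fun _ _ => 0), L^-1).
have stP j : partial_sum (st j).
  elim: j => [|j IH]; last by have [] := nextP (j, st j) IH.
  split => /=.
  - by rewrite invr_gt0 mulVf ?gt_eqF.
  - by apply: smooth_chain_cst; rewrite -mulrA mulVf ?gt_eqF//; lra.
  - by move=> i _ x x' t _ _ _; rewrite mulr0 !mulr0 addr0.
  - exists 0, (1 / 2); split => //; first lra.
    move=> N; have pz l : pairing q (fun=> 0 : R) l = 0.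
      rewrite /pairing (_ : (fun _ => _) = fun=> 0); first by rewrite circint_const !mulr0.
      by apply/funext => t; rewrite mul0r.
    by rewrite !pz normr0 mul0r.
have stepP j : hump_step j (st j) (st j.+1) by have [] := nextP (j, st j) (stP j).
pose w j := (st j).2; pose G j := (st j).1.
have w0 j : 0 <= w j by have [[/ltW]] := stP j.
have wS j : w j.+1 <= w j / 2 by have [_] := stepP j.
have GS j k x : (k <= m)%N -> `|G j.+1 k x - G j k x| <= w j * L.
  move=> km; have [[h E] _ _] := stepP j; rewrite /G E (_ : _ - _ = w j * bump U p h k x).
    rewrite normrM (ger0_norm (w0 j)).
    by apply: ler_wpM2l => //; have [_ b _ _] := bump_chain p h U_chain; exact: b.
  by rewrite addrAC subrr add0r.
have /choice[F FP] : forall kx : nat * R, exists l, (kx.1 <= m)%N ->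
    forall j, `|l - G j kx.1 kx.2| <= 2 * w j * L.
  move=> [k x] /=; have [km|] := boolP (k <= m)%N; last by exists 0.
  have [l lP] := geometric_limit (ltW L0) w0 wS (fun j => GS j k x km).
  by exists l.
pose f k x := F (k, x).
have d0 := halving_small (ltW L0) w0 wS.
have fG j k x : (k <= m)%N -> `|f k x - G j k x| <= 2 * w j * L.
  by move=> km; exact: (FP (k, x)).
have sf : smooth_chain m 2 f.
  apply: (smooth_chain_limit (H := G) (d := fun j => 2 * w j * L)) => //.
  move=> j; have [_ sG _ _] := stP j; apply: smooth_chain_le sG.
  by have := mulr_ge0 (w0 j) (ltW L0); rewrite /w; lra.
exists (f 0%N); split.
- apply: (Delta_of_chain sf); first by rewrite /m leq_addr.
  move=> i iP; apply: (convex_limit (H := fun j x => (-1) ^+ i.-1 * G j (q - 2)%N x)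
    (d := fun j => 2 * w j * L)) => //.
    by move=> j; have [_ _ P _] := stP j; exact: P.
  move=> j x; rewrite -mulrBr normrM normrX normrN1 expr1n mul1r.
  by apply: fG; rewrite /m leq_addr.
- by apply: (W_of_chain sf); rewrite /r /m; lia.
(* Stage j excludes the constant j + 1 at some degree n > j, so any j beyond both n0 and M will
   do. *)
move=> M n0; have [j n0j Mj] := exists_nat_ge M n0.
have [_ _ [n jn na]] := stepP j.
exists n; first exact: ltn_trans n0j jn.
move=> [T [tT dT fT]]; apply: (na (f 0%N)); first by move=> x; exact: fG.
exists T; split => // x; apply: (le_trans (fT x)); apply: ler_wpM2r.
  by rewrite invr_ge0 exprn_ge0.
by apply: (le_trans Mj); rewrite ler_nat.
Qed.

End GlidingHump.

(** * The case r <= q - 2: a jump of the derivative of order q - 2 *)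

Section LowSmoothness.
Variables (R : realType) (q s : nat) (y : nat -> R).
Hypothesis q3 : (3 <= q)%N.
Hypothesis s1 : (1 <= s)%N.
Hypothesis y_decr : forall i : nat, (1 <= i < 2 * s)%N -> y i.+1 < y i.
Hypothesis y_period : y 1%N < y (2 * s)%N + 2 * pi.
Let c := y 1%N.
Implicit Types (t x : R) (G : nat -> R -> R).

Lemma parabola_derivative a b : (c <= a /\ b <= c + 2 * pi) \/ (c - 2 * pi <= a /\ b <= c) ->
  exists k, forall t, a < t < b -> is_derive t 1 (fun t => parabola (t - c)) (k - 2 * t).
Proof.
have der u v u' v' t : is_derive t 1 (fun t => (u * t + v) * (u' * t + v'))
    (u * (u' * t + v') + (u * t + v) * u').
  exact: is_derive_mul (is_derive_affine _ _ _) (is_derive_affine _ _ _).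
move=> [[ca bc]|[ca bc]].
- exists (2 * pi + 2 * c) => t /andP[ta tb].
  have := der 1 (- c) (-1) (2 * pi + c) t.
  rewrite (_ : _ * _ + _ * _ = 2 * pi + 2 * c - 2 * t); last by ring.
  apply: near_eq_is_derive; near=> u.
  have ua : a < u by near: u; exact: lt_nbhsr.
  have ub : u < b by near: u; exact: lt_nbhsl.
  by rewrite parabola_right; [ring|lra].
- exists (2 * c - 2 * pi) => t /andP[ta tb].
  have := der 1 (2 * pi - c) (-1) c t.
  rewrite (_ : _ * _ + _ * _ = 2 * c - 2 * pi - 2 * t); last by ring.
  apply: near_eq_is_derive; near=> u.
  have ua : a < u by near: u; exact: lt_nbhsr.
  have ub : u < b by near: u; exact: lt_nbhsl.
  by rewrite -parabola_periodic parabola_right; [ring|lra].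
Unshelve. all: by end_near.
Qed.

(* The (q-2)-nd derivative jumps at y_1, where q-monotonicity imposes nothing, and is affine
   between two consecutive jumps. *)
Lemma Delta_of_parabola G L k0 k1 : smooth_chain (q - 3) L G ->
  G (q - 3)%N = (fun t => k1 * (parabola (t - c) - k0)) -> Delta q y s (G 0%N).
Proof.
move=> sG Gtop; have [pG _ _ _] := sG; split; last split.
- exact: smooth_chain_continuous sG (leq0n _).
- exact: pG.
move=> i /andP[i1 i2]; set sg := (-1) ^+ i.-1; set a := knot y s i; set b := knot y s i.-1.
have yle j k := @knots_antitone R s y j k y_decr.
have ab : (c <= a /\ b <= c + 2 * pi) \/ (c - 2 * pi <= a /\ b <= c).
  have yp := y_period.
  have ysi : y (2 * s)%N <= y i by apply: yle; lia.
  have aE : a = y i by rewrite /a /knot; case: (i) i1.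
  have [i_1|i_1] := eqVneq i 1%N.
    by left; rewrite aE i_1 /b i_1 /knot eqxx /c; split => //; move: ysi; rewrite i_1; lra.
  right; have bE : b = y i.-1 by rewrite /b /knot ifF//; apply/eqP; lia.
  by rewrite aE bE /c; split; [lra|apply: yle; lia].
have [k dP] := parabola_derivative ab.
pose g j x := sg * G j x.
have dg j : (j < q - 3)%N -> primitive (g j) (g j.+1).
  by move=> jq x; apply: is_derive_scale; exact: (smooth_chain_primitive sG jq).
have E := derive1n_chain dg.
have dtop x : a < x < b -> is_derive x 1 (g (q - 3)%N) (sg * (k1 * (k - 2 * x))).
  move=> xab; rewrite /g Gtop; apply: is_derive_scale; apply: is_derive_scale.
  by apply: is_derive_eq (is_derive_sub (dP x xab) (is_derive_cst k0 x 1)) _; rewrite subr0.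
have Etop x : a < x < b -> derive1n (q - 2) (g 0%N) x = sg * (k1 * (k - 2 * x)).
  move=> xab; rewrite (_ : (q - 2 = (q - 3).+1)%N); last by lia.
  by rewrite derive1nS E// derive1E; case: (dtop x xab).
have cg j : (j <= q - 3)%N -> continuous (g j).
  by move=> jq; apply: continuous_scale; exact: smooth_chain_continuous sG jq.
rewrite -[X in q_monotone _ _ _ X]/(g 0%N); split; last split; last split.
- exact/continuous_subspaceT/cg.
- move=> j jq x xab; rewrite E; last by lia.
  have [jlt|jge] := ltnP j (q - 3); first by case: (dg j jlt x).
  by rewrite (_ : j = (q - 3)%N); [case: (dtop x xab)|lia].
- move=> j jq x xab; have [jle|jgt] := leqP j (q - 3); first by rewrite E//; exact: cg.
  rewrite (_ : j = (q - 2)%N); last by lia.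
  have caff : continuous (fun u : R => sg * (k1 * (k - 2 * u))).
    apply: continuous_scale; apply: continuous_scale; apply: continuous_sub.
      exact: continuous_const.
    by apply: continuous_scale => u; exact: cvg_id.
  have ev : \forall u \near x, sg * (k1 * (k - 2 * u)) = derive1n (q - 2) (g 0%N) u.
    case/andP: xab => xa xb; near=> u.
    have ua : a < u by near: u; exact: lt_nbhsr.
    have ub : u < b by near: u; exact: lt_nbhsl.
    by rewrite Etop// ua.
  have cx : (fun u => sg * (k1 * (k - 2 * u))) @ x --> derive1n (q - 2) (g 0%N) x.
    by rewrite Etop//; exact: caff.
  by apply: cvg_trans cx; exact: near_eq_cvg.
move=> x z t xab zab t01; rewrite !Etop//; last exact: convex_combination_in.
by rewrite le_eqVlt; apply/orP; left; apply/eqP; ring.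
Unshelve. all: by end_near.
Qed.

Lemma phi1_derivative_at_peak : cosum (dcosum (phi1 s y 0)) c = phi0_peak s y / 2.
Proof.
pose l := mul_halves (tail_phases s y 0) [:: (1 : R, 0 : R, 0 : R)].
have tE t : cosum l t = tail_wave s y 0 t.
  by rewrite cosum_mul_halves /cosum big_seq1 /= mul0r addr0 cos0 mulr1 mul1r.
have fE : cosum (phi1 s y 0) = fun t => sin (2^-1 * t + - (2^-1 * c)) * cosum l t.
  by apply/funext => t; rewrite phi1E tE; congr (sin _ * _); rewrite /c; ring.
have d1 := is_derive_mul (is_derive_sin_affine 2^-1 (- (2^-1 * c)) c) (@cosum_primitive R l c).
rewrite -fE subrr cos0 sin0 mul0r addr0 mulr1 tE tail_waveE muln0 expr0 mulr1 in d1.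
have d2 := @cosum_primitive R (phi1 s y 0) c.
by case: d2 => _ <-; case: d1 => _ ->; rewrite mulrC.
Qed.

(** Here f^(q) is 4 pi k1 times the derivative of the point mass at y_1, so pairing it with [phi1]
    for N = 0 gives -4 pi k1 times the slope of [phi1] at y_1, which is half of [phi0_peak]. The
    negative value conflicts with [pairing_phi1_lower]. *)
Lemma pairing_parabola G L k0 k1 : smooth_chain (q - 3) L G ->
  G (q - 3)%N = (fun t => k1 * (parabola (t - c) - k0)) ->
  pairing q (G 0%N) (phi1 s y 0) = - (2 * pi * k1 * phi0_peak s y).
Proof.
move=> sG Gtop; set l := phi1 s y 0.
have hl k : half_degree (2 * (s + 0)) (iter k (@dcosum R) l).
  by apply: half_degree_dcosum; exact: half_degree_test.
have sgn : (-1) ^+ q * (-1) ^+ (q - 3) = - 1 :> R.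
  rewrite -exprD -signr_odd (_ : (q + (q - 3) = (q - 2) * 2 + 1)%N) ?oddD ?oddM ?andbF//=.
  by have := q3; lia.
have := @circint_parts_iter R (q - 3) G (fun k => cosum (iter k.+3 (@dcosum R) l)).
rewrite (_ : (q - 3).+3 = q); last by have := q3; lia.
have [pG _ _ _] := sG.
rewrite /pairing => -> //; first last.
- by move=> k; exact: cosum_primitive.
- by move=> k km; exact: smooth_chain_primitive sG km.
- by move=> k; exact: cosum_continuous.
- by move=> k km; exact: smooth_chain_continuous sG km.
- by move=> k; exact: cosum_periodic (hl k.+3).
rewrite mulrA sgn Gtop.
set l1 := dcosum l; rewrite -[iter 3 _ l]/(iter 2 (@dcosum R) l1).
have cp : continuous (fun t => parabola (t - c) * cosum (iter 2 (@dcosum R) l1) t).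
  apply: continuous_mul; last exact: cosum_continuous.
  exact: (continuous_translate (@parabola_continuous R)).
have z0 k : circint (cosum (iter k.+1 (@dcosum R) l)) = 0.
  apply: (circint_deriv (cosum_periodic (hl k))); first exact: cosum_primitive.
  exact: cosum_continuous.
rewrite (_ : (fun t => _) = fun t => k1 * (parabola (t - c) * cosum (iter 2 (@dcosum R) l1) t
   - k0 * cosum (iter 2 (@dcosum R) l1) t)); last by apply/funext => t; ring.
have ck : continuous (fun t => k0 * cosum (iter 2 (@dcosum R) l1) t).
  exact/continuous_scale/cosum_continuous.
rewrite circintZ; last exact: continuous_sub.
rewrite circintB// circintZ; last exact: cosum_continuous.
rewrite (z0 2%N : circint (cosum (iter 2 (@dcosum R) l1)) = 0).
rewrite (circint_parabola c (hl 1%N)) (z0 0%N : circint (cosum l1) = 0).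
by rewrite -/l1 phi1_derivative_at_peak; field.
Qed.

Lemma low_smoothness r : (1 <= r <= q - 2)%N -> exists f : R -> R, [/\ Delta q y s f, W r f &
  forall M n0, exists2 n, (n0 < n)%N & ~ approximable q y s n f (M / n%:R ^+ r)].
Proof.
move=> /andP[r1 rq].
have pp : periodic2pi (fun t : R => parabola (t - c)).
  by move=> t; rewrite addrAC parabola_periodic.
have cp : continuous (fun t : R => parabola (t - c)).
  exact: (continuous_translate (@parabola_continuous R)).
pose k0 : R := circint (fun t => parabola (t - c)) / (2 * pi).
pose g t : R := parabola (t - c) - k0.
have [||| L [U [sU Ut _]]] := @exists_smooth_chain R g (5 * pi) (q - 3).
- by move=> t; rewrite /g pp.
- move=> x u; rewrite /g (addrAC x u) (_ : _ - k0 - _ = parabola (x - c + u) - parabola (x - c)).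
    exact: parabola_lipschitz.
  by ring.
- rewrite circintB//; last exact: continuous_const.
  by rewrite circint_const /k0 mulrC divfK ?subrr// gt_eqF// pi2_gt0.
have L0 := smooth_chain_ge0 sU.
pose k1 := 2 / (L + 1).
have k10 : 0 < k1 by apply: divr_gt0 => //; lra.
pose G k x := k1 * U k x.
have sG : smooth_chain (q - 3) 2 G.
  have := smooth_chain_scale k1 sU; apply: smooth_chain_le.
  by rewrite gtr0_norm// /k1 mulrAC ler_pdivrMr; lra.
have Gt : G (q - 3)%N = (fun t => k1 * (parabola (t - c) - k0)) by rewrite /G Ut.
have DG := Delta_of_parabola sG Gt.
exists (G 0%N); split => //; first by apply: (W_of_chain sG); have := q3; lia.
have a0 := phi0_peak_gt0 s1 y_decr y_period.
have sq : 0 < s%:R ^+ q :> R by rewrite exprn_gt0// ltr0n.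
(* The pairing -2 pi k1 [phi0_peak] against the lower bound -2 pi e s^q forces e >= e0, whatever the
   degree of the approximant. *)
pose e0 := k1 * phi0_peak s y / s%:R ^+ q.
have e00 : 0 < e0 by rewrite divr_gt0// mulr_gt0.
move=> M n0; have [n n0n Mn] := exists_nat_ge (`|M| / e0 + 1) n0.
exists n => // -[T [tT dT GT]].
have [pG _ _ _] := sG.
have := pairing_phi1_lower q3 s1 y_decr y_period 0
  (smooth_chain_continuous sG (leq0n _)) (pG 0%N (leq0n _)) tT dT GT.
rewrite (pairing_parabola sG Gt) addn0 lerN2 -[leLHS]mulrA -[leLHS]mulrA mulrA.
rewrite ler_pM2l ?pi2_gt0// leNgt => /negP; apply.
rewrite -ltr_pdivlMr// -/e0.
have n_gt0 : 0 < n%:R :> R by rewrite ltr0n; apply: leq_trans n0n.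
have n1 : n%:R <= n%:R ^+ r :> R.
  by rewrite -{1}[n%:R]expr1; apply: ler_weXn2l => //; rewrite ler1n -(ltr0n R).
have nr : 0 < n%:R ^+ r :> R by rewrite exprn_gt0.
rewrite ltr_pdivrMr//; apply: (le_lt_trans (ler_norm M)).
apply: (@lt_le_trans _ _ (e0 * n%:R)); last by rewrite ler_pM2l.
by rewrite mulrC -ltr_pdivrMr//; lra.
Qed.

End LowSmoothness.

Theorem theorem1p2 (R : realType) (q r s : nat) (y : nat -> R) :
  (3 <= q)%N -> (1 <= r)%N -> (1 <= s)%N ->
  (forall i : nat, (1 <= i < 2 * s)%N -> y i.+1 < y i) ->
  y 1%N < y (2 * s)%N + 2 * pi ->
  exists f : R -> R, Delta q y s f /\ W r f /\
    limn_esup (fun n : nat => ((n%:R ^+ r)%:E * En q y s n f)%E) = +oo%E.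
Proof.
move=> q3 r1 s1 y_decr y_period.
suff [f [Df Wf Ef]] : exists f : R -> R, [/\ Delta q y s f, W r f &
    forall M n0, exists2 n, (n0 < n)%N & ~ approximable q y s n f (M / n%:R ^+ r)].
  by exists f; split => //; split => //; exact: limsup_En_infty.
(* For r <= q - 2 the class W^r leaves f^(q-2) free to jump. From r = q - 1 on, f^(q-2) is
   continuous and p counts the further derivatives. *)
have [rq|qr] := leqP r (q - 2).
  by apply: low_smoothness => //; rewrite r1.
have [p ->] : exists p, r = (q - 1 + p)%N by exists (r - (q - 1))%N; lia.
pose c := y 1%N; pose z := (y 1%N + y 2%N) / 2.
have [L [U [sU Ut _]]] := exists_smooth_chain (q - 2 + p) (@two_kinks_periodic R c z)
  (@two_kinks_lipschitz R c z) (two_kinks_circint c z).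
have L0 := smooth_chain_ge0 sU.
have L1 : L <= L + 1 by rewrite lerDl.
apply: (gliding_hump q3 s1 y_decr y_period _ (smooth_chain_le L1 sU) Ut).
by rewrite ltr_wpDl.
Qed.
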